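(* Fix a nonempty $I\subseteq[d]$. Let $f\in L^1(S)$ be a probability density and assume $V_I^{\mathrm{ext}}(f;S)<\infty$. Then, for every $\varphi\in L^\infty(S)$, $$|\mathbb E_f[\varphi]|\le2^{-|I|}\,\Lambda_{\mathrm{mix}}^I(\mathcal P_I\varphi)\,V_I^{\mathrm{ext}}(f;S)+\|\mathcal R_I\varphi\|_{L^\infty(S)}.$$
   Context: Let $d\ge 1$, $[d]=\{1,\dots,d\}$, and let $S=\prod_{i=1}^d[a_i,b_i]\subset\mathbb R^d$ be a box with $a_i<b_i$. For $I\subseteq[d]$ write $\omega_I=(\omega_i)_{i\in I}$, $\omega_{-I}=(\omega_j)_{j\notin I}$, $S_I=\prod_{i\in I}[a_i,b_i]$, $S_{-I}=\prod_{j\notin I}[a_j,b_j]$ (a singleton if $I=[d]$), and $-i$ for $-\{i\}$. A probability density on $S$ is a nonnegative integrable function with integral $1$; $\mathbb E_f[\varphi]=\int_S\varphi f\,d\omega$. $(\Pi_i\varphi)(\omega)=\frac1{b_i-a_i}\int_{a_i}^{b_i}\varphi(\omega_{-i},t)\,dt$ ($t$ inserted in coordinate $i$); these commute. $\mathcal P_I=\prod_{i\in I}(\mathrm{Id}-\Pi_i)$, $\mathcal R_I=\mathrm{Id}-\mathcal P_I$. The mixed envelope is $$\Lambda_{\mathrm{mix}}^I(\varphi)=\operatorname*{ess\,sup}_{\omega_{-I}\in S_{-I}}\int_{S_I}|\varphi(\omega_{-I},t_I)|\,dt_I.$$ Distributional mixed derivative: for $U\subset\mathbb R^d$ open, $h\in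 L^1_{\mathrm{loc}}(U)$ and $I=\{i_1<\cdots<i_k\}$, $D_Ih$ is the distribution $\langle D_Ih,\zeta\rangle=(-1)^k\int_Uh\,\partial_I\zeta\,dx$, $\zeta\in C_c^\infty(U)$, with $\partial_I=\partial_{i_1}\cdots\partial_{i_k}$. $\mathcal M(U)$ denotes the finite signed Radon measures on $U$; if $D_Ih\in\mathcal M(U)$, $|D_Ih|(U)$ is its total variation. Extension mixed-variation seminorm: for $f\in L^1(S)$, $$V_I^{\mathrm{ext}}(f;S)=\inf\{|D_I\bar f|(\mathbb R^d):\ \bar f\in L^1(\mathbb R^d),\ \bar f=f\text{ a.e. on }S,\ D_I\bar f\in\mathcal M(\mathbb R^d)\},$$ with value $+\infty$ if no such $\bar f$ exists. *)

(* Defs.v *)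
From HB Require Import structures.
From mathcomp Require Import all_boot all_order all_algebra.
From mathcomp Require Import all_classical all_reals all_analysis ess_sup_inf.

Set Implicit Arguments.
Unset Strict Implicit.
Unset Printing Implicit Defensive.

Import Order.TTheory GRing.Theory Num.Theory.
Import numFieldNormedType.Exports.

Local Open Scope classical_set_scope.
Local Open Scope ring_scope.

(* R^n is 'rV[R]_n, with the sigma-algebra generated by the coordinates, which
   is also its Borel sigma-algebra. *)
Definition rV_display : measure_display. Proof. exact. Qed.

Section measurable_rV.
Variables (R : realType) (n : nat).

Definition rV_coord (i : 'I_n) (x : 'rV[R]_n) : R := x ord0 i.

Let rV_set0 : g_sigma_preimage rV_coord set0.
Proof. exact: sigma_algebra0. Qed.

Let rV_setC A : g_sigma_preimage rV_coord A -> g_sigma_preimage rV_coord (~` A).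
Proof. exact: sigma_algebraC. Qed.

Let rV_bigcup (F : _^nat) : (forall i, g_sigma_preimage rV_coord (F i)) ->
  g_sigma_preimage rV_coord (\bigcup_i (F i)).
Proof. exact: sigma_algebra_bigcup. Qed.

HB.instance Definition _ := @isMeasurable.Build rV_display
  'rV[R]_n (g_sigma_preimage rV_coord) rV_set0 rV_setC rV_bigcup.

Lemma measurable_rV_coord (i : 'I_n) : measurable_fun setT (rV_coord i).
Proof.
move=> _ Y mY; rewrite setTI; apply: sub_sigma_algebra => /=.
rewrite -bigcup_seq/=; exists i => /=; first by rewrite mem_index_enum.
by exists Y => //; rewrite setTI.
Qed.

Lemma measurable_fun_rV d (T : measurableType d) (f : T -> 'rV[R]_n) :
  (forall i, measurable_fun setT (rV_coord i \o f)) -> measurable_fun setT f.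
Proof.
move=> mf _ A mA; rewrite setTI; move: A mA.
apply: smallest_sub.
  split => [|A mA|F mF].
  - by rewrite preimage_set0.
  - by rewrite setTD preimage_setC; exact: measurableC.
  - by rewrite preimage_bigcup; exact: bigcupT_measurable.
rewrite -bigcup_seq/=; apply: bigcup_sub => i _ A [B mB <-].
rewrite setTI -[X in measurable X]setTI.
by apply: (mf i).
Qed.

End measurable_rV.

Section lebesgue_rV.
Local Open Scope ereal_scope.
Variable R : realType.

Definition row_cons n (tx : measurableTypeR R * 'rV[R]_n) : 'rV[R]_n.+1 :=
  \row_i (if unlift ord0 i is Some j then tx.2 ord0 j else tx.1).

Lemma row_cons_head n tx : @row_cons n tx ord0 ord0 = tx.1.
Proof. by rewrite mxE unlift_none. Qed.

Lemma row_cons_tail n tx i : @row_cons n tx ord0 (lift ord0 i) = tx.2 ord0 i.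
Proof. by rewrite mxE liftK. Qed.

Lemma measurable_row_cons n : measurable_fun setT (@row_cons n).
Proof.
apply: measurable_fun_rV => i.
case: (unliftP ord0 i) => [j ->|->].
  rewrite (_ : _ \o _ = @rV_coord R n j \o snd); last first.
    by apply/funext => tx /=; rewrite /rV_coord row_cons_tail.
  exact: measurableT_comp (measurable_rV_coord j) measurable_snd.
rewrite (_ : _ \o _ = fst); last first.
  by apply/funext => tx /=; rewrite /rV_coord row_cons_head.
exact: measurable_fst.
Qed.

Lemma row_cons_inj n : injective (@row_cons n).
Proof.
move=> [t x] [u y] E; congr pair.
  by have := congr1 (fun z : 'rV_n.+1 => z ord0 ord0) E; rewrite !row_cons_head.
apply/rowP => i.
by have := congr1 (fun z : 'rV_n.+1 => z ord0 (lift ord0 i)) E;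
  rewrite !row_cons_tail.
Qed.

Section cons_measure.
Variables (n : nat) (m : {sigma_finite_measure set 'rV[R]_n -> \bar R}).

Definition cons_measure : set 'rV[R]_n.+1 -> \bar R :=
  pushforward (@lebesgue_measure R \x m) (@row_cons n).

Let measurable_preimage A : measurable A -> measurable (@row_cons n @^-1` A).
Proof.
by move=> mA; rewrite -[X in measurable X]setTI; exact: measurable_row_cons.
Qed.

Let cons_measure0 : cons_measure set0 = 0.
Proof. by rewrite /cons_measure /pushforward preimage_set0 measure0. Qed.

Let cons_measure_ge0 A : 0 <= cons_measure A.
Proof. by rewrite /cons_measure /pushforward; apply: measure_ge0. Qed.

Let cons_measure_sigma_additive : semi_sigma_additive cons_measure.
Proof.
move=> F mF tF mUF; rewrite /cons_measure /pushforward preimage_bigcup.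
apply: measure_semi_sigma_additive.
- by move=> k; exact: measurable_preimage.
- apply/trivIsetP => /= i j _ _ ij; rewrite -preimage_setI.
  by move/trivIsetP : tF => /(_ _ _ _ _ ij) ->//; rewrite preimage_set0.
- by rewrite -preimage_bigcup; exact: measurable_preimage.
Qed.

HB.instance Definition _ := isMeasure.Build _ _ _
  cons_measure cons_measure0 cons_measure_ge0 cons_measure_sigma_additive.

Let cons_measure_sigma_finite : sigma_finite setT cons_measure.
Proof.
have /sigma_finiteP[F [TF ndF Foo]] := sigma_finiteT (@lebesgue_measure R).
have /sigma_finiteP[G [TG ndG Goo]] := sigma_finiteT m.
exists (fun k => [set x : 'rV[R]_n.+1 | F k (x ord0 ord0)] `&`
    [set x : 'rV[R]_n.+1 | G k (\row_i x ord0 (lift ord0 i))]).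
  apply/seteqP; split => // x _.
  have [k _ Fk] : (\bigcup_i F i) (x ord0 ord0) by rewrite -TF.
  have [l _ Gl] : (\bigcup_i G i) (\row_i x ord0 (lift ord0 i)) by rewrite -TG.
  exists (maxn k l) => //; split => /=.
  - by move: Fk; exact/subsetPset/ndF/leq_maxl.
  - by move: Gl; exact/subsetPset/ndG/leq_maxr.
move=> k; have [mF Fk] := Foo k; have [mG Gk] := Goo k.
split.
  apply: measurableI.
    by rewrite -[X in measurable X]setTI; exact: (@measurable_rV_coord R n.+1 ord0).
  suff mt : measurable_fun setT
      (fun x : 'rV[R]_n.+1 => \row_i x ord0 (lift ord0 i) : 'rV[R]_n).
    by rewrite -[X in measurable X]setTI; exact: mt.
  apply: measurable_fun_rV => i.
  rewrite (_ : _ \o _ = @rV_coord R n.+1 (lift ord0 i)).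
    exact: measurable_rV_coord.
  by apply/funext => x /=; rewrite /rV_coord mxE.
rewrite /cons_measure /pushforward (_ : _ @^-1` _ = F k `*` G k).
  by rewrite product_measure1E// lte_mul_pinfty// ge0_fin_numE.
apply/seteqP; split=> -[t x] /=.
  rewrite row_cons_head => -[Ft]; rewrite (_ : \row__ _ = x)//.
  by apply/rowP => i; rewrite mxE row_cons_tail.
move=> [Ft Gx]; rewrite row_cons_head; split => //.
rewrite (_ : \row__ _ = x)//.
by apply/rowP => i; rewrite mxE row_cons_tail.
Qed.

HB.instance Definition _ := Measure_isSigmaFinite.Build _ _ _ cons_measure
  cons_measure_sigma_finite.

End cons_measure.

(* Lebesgue measure on R^n, as an iterated product; R^0 is a single point, of
   mass 1. *)
Fixpoint lebesgue_rV n : {sigma_finite_measure set 'rV[R]_n -> \bar R} :=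
  if n is n'.+1 then cons_measure (lebesgue_rV n')
  else (dirac (0%R : 'rV[R]_0) : set 'rV[R]_0 -> \bar R).

Definition box n (a b : 'rV[R]_n) : set 'rV[R]_n :=
  [set x : 'rV[R]_n | forall i, (a ord0 i <= x ord0 i <= b ord0 i)%R].

Lemma measurable_box n (a b : 'rV[R]_n) : measurable (box a b).
Proof.
rewrite (_ : box a b =
    \big[setI/setT]_(i < n) (@rV_coord R n i @^-1` `[a ord0 i, b ord0 i]%classic)).
  apply: bigsetI_measurable => i _; rewrite -[X in measurable X]setTI.
  by apply: measurable_rV_coord => //; exact: measurable_itv.
rewrite -bigcap_seq/=.
apply/seteqP; split => [x abx i _ /=|x abx i].
  by rewrite in_itv/=; exact: abx.
by have := abx i; rewrite /= mem_index_enum in_itv/= => /(_ isT).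
Qed.

Lemma lebesgue_rV_box n (a b : 'rV[R]_n) : (forall i, a ord0 i <= b ord0 i)%R ->
  lebesgue_rV n (box a b) = (\prod_(i < n) (b ord0 i - a ord0 i))%:E.
Proof.
elim: n a b => [|n IH] a b ab.
  rewrite big_ord0 /= diracE mem_set//=. by case.
rewrite big_ord_recl /= /cons_measure /pushforward.
set a' : 'rV[R]_n := \row_i a ord0 (lift ord0 i).
set b' : 'rV[R]_n := \row_i b ord0 (lift ord0 i).
rewrite (_ : _ @^-1` _ = `[a ord0 ord0, b ord0 ord0]%classic `*` box a' b').
  rewrite product_measure1E//; [|exact: measurable_box].
  rewrite EFinM; congr (_ * _)%E.
    transitivity (lebesgue_measure `[a ord0 ord0, b ord0 ord0]%classic) => //.
    rewrite lebesgue_measure_itv/= lte_fin; case: ltP => [_|ba]; first by rewrite EFinB.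
    by rewrite (@le_anti _ _ (a ord0 ord0) (b ord0 ord0)) ?subrr// ab ba.
  rewrite IH; last by move=> i; rewrite !mxE.
  by congr EFin; apply: eq_bigr => i _; rewrite !mxE.
apply/seteqP; split => -[t x] /=; rewrite in_itv/=.
  move=> H; split; first by have := H ord0; rewrite row_cons_head.
  by move=> i; rewrite !mxE -[x _ _](row_cons_tail (t, x)); exact: H.
move=> [H1 H2] i; case: (unliftP ord0 i) => [j ->|->].
  by rewrite row_cons_tail/=; have := H2 j; rewrite !mxE.
by rewrite row_cons_head.
Qed.

End lebesgue_rV.
Arguments lebesgue_rV {R n}.

Section box_operators.
Variables (R : realType) (d : nat).
Implicit Types (a b x : 'rV[R]_d) (I : {set 'I_d}) (phi : 'rV[R]_d -> R).

(* Lebesgue measure restricted to the box. L^p of the box is Lfun for this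
   measure: functions on the box are represented by Borel functions on R^n whose
   values outside the box are irrelevant. *)
Definition box_measure n (a b : 'rV[R]_n) : set 'rV[R]_n -> \bar R :=
  mrestr lebesgue_rV (measurable_box a b).
HB.instance Definition _ n (a b : 'rV[R]_n) := Measure.on (box_measure a b).

Definition proj_rV I x : 'rV[R]_#|I| := \row_k x ord0 (enum_val k).

(* The point of R^d with I-coordinates t and remaining coordinates u; exactly
   one of the two sums has a term, and only one. *)
Definition merge_rV I (u : 'rV[R]_#|~: I|) (t : 'rV[R]_#|I|) : 'rV[R]_d :=
  \row_j (\sum_(k < #|I| | enum_val k == j) t ord0 k +
          \sum_(k < #|~: I| | enum_val k == j) u ord0 k).

Lemma merge_rVK I x : merge_rV (proj_rV (~: I) x) (proj_rV I x) = x.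
Proof.
have sumE (J : {set 'I_d}) j :
    \sum_(k < #|J| | enum_val k == j) proj_rV J x ord0 k =
    if j \in J then x ord0 j else 0.
  case: ifPn => jJ.
    rewrite (big_pred1 (enum_rank_in jJ j)) => [|k].
      by rewrite mxE enum_rankK_in.
    apply/eqP/eqP => [kj|->]; last by rewrite enum_rankK_in.
    by apply: enum_val_inj; rewrite enum_rankK_in.
  apply: big_pred0 => k; apply: contraNF jJ => /eqP <-.
  exact: enum_valP.
apply/rowP => j; rewrite mxE !sumE finset.in_setC.
by case: (j \in I); rewrite /= ?addr0 ?add0r.
Qed.

Definition update_rV (i : 'I_d) x (t : R) : 'rV[R]_d :=
  \row_j (if j == i then t else x ord0 j).

Definition coord_mean a b (i : 'I_d) phi : 'rV[R]_d -> R := fun x =>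
  (b ord0 i - a ord0 i)^-1 *
  \int[lebesgue_measure]_(t in `[a ord0 i, b ord0 i]) phi (update_rV i x t).

Definition mixed_proj a b I : ('rV[R]_d -> R) -> 'rV[R]_d -> R :=
  \big[comp/id]_(i in I) (fun phi => phi \- coord_mean a b i phi).

Definition mixed_rem a b I phi : 'rV[R]_d -> R := phi \- mixed_proj a b I phi.

Definition mixed_envelope a b I phi : \bar R :=
  ess_sup (box_measure (proj_rV (~: I) a) (proj_rV (~: I) b))
    (fun u => \int[box_measure (proj_rV I a) (proj_rV I b)]_t
                `|phi (merge_rV u t)|%:E)%E.

Definition probability_density a b (f : 'rV[R]_d -> R) :=
  [/\ f \in Lfun (box_measure a b) 1,
      {ae box_measure a b, forall x, 0 <= f x} &
      \int[box_measure a b]_x f x = 1].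

Definition density_expectation a b (f phi : 'rV[R]_d -> R) : R :=
  \int[box_measure a b]_x (phi x * f x).

End box_operators.

Section mixed_variation.
Variables (R : realType) (d : nat).
Implicit Types (h f zeta : 'rV[R]_d -> R) (I : {set 'I_d}).

(* partials [:: i1; ...; ik] zeta is d_i1 ... d_ik zeta. *)
Definition partials (s : seq 'I_d) zeta : 'rV[R]_d -> R :=
  foldr (fun i g => 'D_(delta_mx ord0 i) g) zeta s.

Definition smooth zeta := forall s : seq 'I_d,
  continuous (partials s zeta) /\
  forall i x, derivable (partials s zeta) x (delta_mx ord0 i).

Definition test_function zeta :=
  smooth zeta /\ compact (closure [set x | zeta x != 0]).

Definition mixed_derivative I h zeta : R :=
  (-1) ^+ #|I| * \int[lebesgue_rV]_x (h x * partials (enum I) zeta x).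

(* Finite signed Radon measures on R^d are the charges on its Borel
   sigma-algebra. The integral below and charge_variation do not depend on the
   Hahn decomposition through which they are computed. *)
Definition charge_integral (nu : {charge set 'rV[R]_d -> \bar R})
    (P N : set 'rV[R]_d) (nuPN : hahn_decomposition nu P N) zeta : R :=
  \int[jordan_pos nuPN]_x zeta x - \int[jordan_neg nuPN]_x zeta x.

Definition mixed_derivative_eq I h (nu : {charge set 'rV[R]_d -> \bar R})
    (P N : set 'rV[R]_d) (nuPN : hahn_decomposition nu P N) :=
  forall zeta, test_function zeta ->
    mixed_derivative I h zeta = charge_integral nuPN zeta.

Definition ext_mixed_variation (a b : 'rV[R]_d) I f : \bar R :=
  ereal_inf [set v | exists h (nu : {charge set 'rV[R]_d -> \bar R})
      (P N : set 'rV[R]_d) (nuPN : hahn_decomposition nu P N),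
    [/\ h \in Lfun lebesgue_rV 1,
        {ae box_measure a b, forall x, h x = f x},
        mixed_derivative_eq I h nuPN &
        v = charge_variation nuPN setT]].

End mixed_variation.

(* Main.v *)
Require Import Defs.
From HB Require Import structures.
From mathcomp Require Import all_boot all_order all_algebra fingroup perm.
From mathcomp Require Import all_classical all_reals all_analysis ess_sup_inf measurable_realfun.
From mathcomp Require Import ring lra.

Set Implicit Arguments.
Unset Strict Implicit.
Unset Printing Implicit Defensive.

Import Order.TTheory GRing.Theory Num.Theory.
Import numFieldNormedType.Exports.

Local Open Scope classical_set_scope.
Local Open Scope ring_scope.

(** Put [psi := P_I phi], so that [phi = psi + R_I phi]. The density [f] has mass
    one, hence [R_I phi] contributes at most its essential supremum, and what
    remains is to bound [int_S f psi].

    For [i] in [I] the function [psi] has mean zero in the coordinate [i], so its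
    primitive in that coordinate vanishes at both ends of [[a_i, b_i]] and equals
    [int (1/2) sgn(s - t) psi(t) dt]. Integrating once in every coordinate of [I]
    gives a function [G] on the box, zero on the faces transverse to [I], with
    [d_I G = psi] and, almost everywhere,
    [|G| <= 2^-|I| int_(S_I) |psi| <= 2^-|I| Lambda]; the factor [2^-|I|] is the
    product of the [|I|] factors [1/2]. Pairing [G] with the mixed derivative of
    an extension [h] of [f] gives
    [|int_S f psi| = |int h d_I G| = |int G dD_I h| <= 2^-|I| Lambda |D_I h|(R^d)],
    and the infimum over the extensions is the claim.

    The measure [D_I h] may charge Lebesgue-null sets, while [G] is not smooth and
    obeys its bound only almost everywhere, so [G] is mollified. The mollified function
    is written down directly as [int_S psi(y) prod_i k_i(x_i, y_i) dy], where each
    [k_i] is built from a smooth step on the line ([step_kernel]). It is then a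
    test function for elementary reasons ([kernel_integral_test_function]), and
    each one-dimensional kernel with [i] in [I] is at most [1/2], so that the bound
    [2^-|I| Lambda] holds at every point ([antiderivative_bound]). Its derivative
    along [I] is the plain mollification of [psi], because the terms of [d k_i]
    that do not depend on [y_i] are orthogonal to [psi]
    ([partials_antiderivative]). This orthogonality follows from the
    self-adjointness of the coordinate means ([coord_mean_adjoint],
    [mixed_proj_orthogonal]), which makes it insensitive to the order in which the
    operators [Id - Pi_i] are composed.

    It remains to let the mollification scale tend to zero
    ([mollification_cvg]): as the mollifications are uniformly bounded, the
    integrals against [h] converge as soon as they do for indicators of boxes,
    where the mollifier is integrated explicitly
    ([weak_cvg_integrable], [cvg_mollification_ocbox]). *)

(** * A smooth step on the line *)

Section derivative_from_quadratic.
Context {R : realType} {V : normedModType R}.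

(** Difference quotients are passed to the limit here once and for all: the estimate
    is met both by the flat functions at the ends of their support and by integrals
    depending on a parameter. *)
Lemma is_derive_quadratic (f : V -> R) (x v : V) (l C : R) :
  (forall h, `|h| <= 1 -> `|f (h *: v + x) - f x - h * l| <= C * h ^+ 2) ->
  is_derive x v f l.
Proof.
move=> fC.
have C0 : 0 <= C.
  have := fC 1; rewrite normr1 lexx expr1n mulr1 => /(_ isT).
  exact: le_trans (normr_ge0 _).
have lim : (fun h : R => h^-1 *: (f (h *: v + x) - f x)) @ 0^' --> l.
  apply/cvgrPdist_le => /= e e0.
  have Ce : 0 < Num.min 1 (e / (C + 1)).
    by rewrite lt_min ltr01 divr_gt0// ltr_wpDl.
  near=> h.
  have h0 : h != 0 by near: h; exact: nbhs_dnbhs_neq.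
  have : `|h| < Num.min 1 (e / (C + 1)).
    by near: h; apply: dnbhs0_lt.
  rewrite lt_min => /andP[h1 he].
  rewrite -[l](mulKf h0) -mulrBr normrM distrC normfV ler_pdivrMl ?normr_gt0//.
  apply: (le_trans (fC _ (ltW h1))).
  rewrite -real_normK ?num_real// expr2 mulrCA ler_wpM2l//.
  apply: (@le_trans _ _ ((C + 1) * `|h|)); first by rewrite ler_wpM2r// lerDl.
  by rewrite mulrC -ler_pdivlMr ?ltr_wpDl// ltW.
apply: DeriveDef.
  by apply/cvg_ex; exists l.
exact/cvg_lim.
Unshelve. all: by end_near. Qed.

End derivative_from_quadratic.

Section smooth_step.
Context {R : realType}.
Implicit Types (q : {poly R}) (x : R).

Let W : {poly R} := - 'X * (1 + 'X).

Let WE x : W.[x] = - x * (1 + x).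
Proof. by rewrite /W !hornerE. Qed.

Let W_gt0 x : -1 < x < 0 -> 0 < W.[x].
Proof.
move=> /andP[x1 x0]; rewrite WE mulr_gt0// ?oppr_gt0//.
by rewrite addrC -ltrBlDr sub0r.
Qed.

(** The functions [q(x) w^-k exp(-1/w)] with [w = -x(1+x)], extended by zero
    outside of [(-1, 0)]. Indexing them by the pair [(q, k)] makes the family closed
    under differentiation, which is all that smoothness of the bump requires. *)
Definition flat (qk : {poly R} * nat) x : R :=
  if -1 < x < 0 then qk.1.[x] * W.[x] ^- qk.2 * expR (- W.[x]^-1) else 0.

Definition flat_next (qk : {poly R} * nat) : {poly R} * nat :=
  (qk.1^`() * W ^+ 2 - qk.1 * W^`() * W *+ qk.2 + qk.1 * W^`(), qk.2.+2).

Lemma horner_bound q : exists2 B : R, 0 <= B & forall x, -1 <= x <= 1 -> `|q.[x]| <= B.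
Proof.
exists (\sum_(i < size q) `|q`_i|); first exact: sumr_ge0.
move=> x; rewrite -ler_norml => x1; rewrite horner_coef.
apply: (le_trans (ler_norm_sum _ _ _)); apply: ler_sum => i _.
by rewrite normrM normrX ler_piMr// exprn_ile1.
Qed.

(** The exponential beats every power of [1/w]; the factor [w^2] that is kept
    vanishes to second order at both ends of the support. *)
Lemma flat_bound qk : exists2 C : R, 0 <= C & forall x, `|flat qk x| <= C * W.[x] ^+ 2.
Proof.
case: qk => q k; have [B B0 qB] := horner_bound q.
have f0 : 0 <= (k.+2)`!%:R :> R by [].
exists (B * (k.+2)`!%:R) => [|x]; first exact: mulr_ge0.
rewrite /flat /=; case: ifPn => [xx|_]; last first.
  by rewrite normr0; apply: mulr_ge0; [exact: mulr_ge0|exact: sqr_ge0].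
have w0 := W_gt0 xx; have /andP[x1 x0] := xx.
rewrite !normrM -!mulrA ler_pM//.
  by rewrite qB// (ltW x1)/= (le_trans (ltW x0)).
rewrite (ger0_norm (_ : 0 <= W.[x] ^- k)); last by rewrite invr_ge0 exprn_ge0// ltW.
rewrite (ger0_norm (expR_ge0 _)) expRN.
have := @expR_ge1Dxn R (W.[x]^-1) k.+1.
rewrite invr_ge0 => /(_ (ltW w0)) e1.
have {}e1 : W.[x] ^- k.+2 / (k.+2)`!%:R <= expR W.[x]^-1.
  by rewrite -exprVn (le_trans _ e1)// lerDr.
rewrite ler_pdivrMr ?expR_gt0//.
move: e1; rewrite ler_pdivrMr ?ltr0n ?fact_gt0// => e1.
have -> : W.[x] ^- k = W.[x] ^+ 2 * W.[x] ^- k.+2.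
  by rewrite !exprS; field; rewrite expf_neq0 gt_eqF.
rewrite (_ : _ * _ * expR _ = W.[x] ^+ 2 * (expR W.[x]^-1 * (k.+2)`!%:R)); last by ring.
by rewrite ler_wpM2l ?sqr_ge0//.
Qed.

Lemma flat_bounded qk : exists B : R, forall x, `|flat qk x| <= B.
Proof.
have [C C0 fC] := flat_bound qk; exists C => x.
case xx : (-1 < x < 0); last by rewrite /flat xx normr0.
apply: (le_trans (fC x)); rewrite ler_piMr// exprn_ile1// ?(ltW (W_gt0 xx))//.
by rewrite WE; move: xx => /andP[? ?]; nra.
Qed.

(** Inside [(-1, 0)] this is the product rule. At any other point the function is
    zero there and, by [flat_bound], at most a multiple of the squared distance
    nearby. *)
Lemma is_derive_flat qk x : is_derive x 1 (flat qk) (flat (flat_next qk) x).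
Proof.
case xx : (-1 < x < 0).
  have w0 := W_gt0 xx; have /andP[x1 x0] := xx.
  pose g := (horner qk.1 * ((fun y => W.[y]^-1) ^+ qk.2)) * (expR \o (- (fun y => W.[y]^-1))).
  apply: (@near_eq_is_derive _ _ _ g).
    - near=> y; rewrite /flat; case: ifPn => [_|].
        rewrite /g /=; congr (_ * _ * _).
        by rewrite fctE exprVn.
      move=> /negP[]; apply/andP; split; near: y.
        exact: lt_nbhsr.
      exact: lt_nbhsl.
  have dV : is_derive x 1 (fun y => W.[y]^-1) (- W.[x] ^- 2 * W^`().[x]).
    by apply: is_deriveV; rewrite gt_eqF.
  rewrite /g.
  apply: is_derive_eq.
  clear g dV; clearbody W; rewrite /flat xx /flat_next /= !hornerE !hornerMn !hornerE.
  rewrite !fctE/=; move: (expR _) => E.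
  have {w0}w0 : W.[x] != 0 by rewrite gt_eqF.
  case: qk => q k /=; rewrite /GRing.scale/= -!exprVn.
  case: k => [|k]; rewrite ?mulr0n ?expr0 ?mul0r.
    by field.
  rewrite -[_ *+ k.+1]mulr_natl /= !exprS; move: (_ ^+ k) => P.
  by field.
rewrite [X in is_derive _ _ _ X](_ : _ = 0); last by rewrite /flat xx.
have [C C0 fC] := flat_bound qk.
apply: (@is_derive_quadratic _ _ _ _ _ _ C) => h _.
rewrite {2}/flat xx mulr0 !subr0 scaler1.
case yy : (-1 < h + x < 0); last first.
  by rewrite /flat yy normr0 mulr_ge0// sqr_ge0.
apply: (le_trans (fC _)); rewrite ler_wpM2l//.
rewrite -(real_normK (num_real h)).
have w0 := W_gt0 yy; rewrite lerXn2r ?nnegrE ?(ltW w0)// WE.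
move: xx yy => /negP/negP; rewrite negb_and -!leNgt => xx /andP[y1 y0].
have [h0|h0] := leP 0 h; [rewrite ger0_norm//|rewrite ltr0_norm//].
  by case/orP: xx => xx; nra.
by case/orP: xx => xx; nra.
Unshelve. all: by end_near. Qed.

Lemma continuous_is_derive (f f' : R -> R) :
  (forall x, is_derive x 1 f (f' x)) -> continuous f.
Proof.
by move=> df x; apply/differentiable_continuous/derivable1_diffP; case: (df x).
Qed.

(** The step is the normalized primitive of the bump. A smooth function comes with
    the sequence of its derivatives, so that no iterated derivative operator is
    needed when it is shifted, rescaled or multiplied. *)
Lemma smooth_step_ex : exists F : nat -> R -> R, [/\
  forall m x, is_derive x 1 (F m) (F m.+1 x),
  forall m, exists B, forall x, `|F m x| <= B,
  forall x, x <= -1 -> F 0%N x = 0,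
  forall x, 0 <= x -> F 0%N x = 1 &
  forall x, 0 <= F 1%N x].
Proof.
pose b m := flat (iter m flat_next (1, 0%N)).
have db m x : is_derive x 1 (b m) (b m.+1 x) by exact: is_derive_flat.
have b0E x : b 0%N x = if -1 < x < 0 then expR (- W.[x]^-1) else 0.
  by rewrite /b /= /flat /= hornerE invr1 !mul1r.
have b_ge0 x : 0 <= b 0%N x by rewrite b0E; case: ifP => // _; exact: expR_ge0.
have cb m : continuous (b m) := continuous_is_derive (db m).
have mb m : measurable_fun setT (b m).
  by apply: measurable_realfun.continuous_measurable_fun; exact: cb.
have [B bB] := flat_bounded (1, 0%N).
have B0 : 0 <= B := le_trans (normr_ge0 _) (bB 0).
have ib y : lebesgue_measure.-integrable `]-oo, y] (EFin \o b 0%N).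
  have iI : lebesgue_measure.-integrable `[-1, 0] (EFin \o b 0%N).
    apply: continuous_compact_integrable; first exact: segment_compact.
    exact/continuous_subspaceT/cb.
  have -> : EFin \o b 0%N = (EFin \o b 0%N) \_ `[-1, 0].
    apply/funext => x; rewrite patchE; case: ifPn => //.
    rewrite notin_setE /= in_itv/= => xN; rewrite b0E; case: ifP => //.
    by move=> /andP[x1 x0]; case: xN; rewrite !ltW.
  apply: (@integrableS _ _ _ _ setT) => //.
  by apply/(integrable_mkcond _ _).1.
pose P y := \int[lebesgue_measure]_(t in `]-oo, y]) b 0%N t.
have dP x : is_derive x 1 P (b 0%N x).
  have xx : x < x + 1 by rewrite ltrDl.
  have [|dx dE] := @continuous_FTC1 R (b 0%N) -oo%O x (x + 1) xx (ib _) _ (cb 0%N x).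
    by rewrite ltNyr.
  by apply: DeriveDef => //; rewrite -derive1E.
have cP : continuous P := continuous_is_derive dP.
have Pmvt x y : x < y -> exists2 c, x < c < y & P y - P x = b 0%N c * (y - x).
  move=> xy; have [c cxy Ec] := @MVT R P (b 0%N) x y xy (fun z _ => dP z)
    (continuous_subspaceT cP).
  by exists c => //; move: cxy; rewrite in_itv.
have P1 x : x <= -1 -> P x = 0.
  move=> x1; rewrite /P /Rintegral integral0_eq// => t /=.
  rewrite in_itv/= => tx; rewrite b0E; case: ifP => // /andP[t1 _].
  by move: t1; rewrite ltNge (le_trans tx).
have P0_gt0 : 0 < P 0.
  have [|c c0 Ec] := Pmvt (-1) 0; first by lra.
  move: Ec; rewrite (P1 (-1))// !subr0 sub0r opprK mulr1 => ->.
  by rewrite b0E c0 expR_gt0.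
have P0 x : 0 <= x -> P x = P 0.
  rewrite le_eqVlt => /predU1P[<-//|x0]; have [c /andP[c0 _] Ec] := Pmvt _ _ x0.
  by apply/eqP; rewrite -subr_eq0 Ec b0E ltNge [_ < 0]ltNge (ltW c0) andbF mul0r.
pose F m x := (P 0)^-1 * (if m is k.+1 then b k x else P x).
exists F; split => [m x|m|x x1|x x0|x].
- rewrite /F; case: m => [|m]; [have df := dP x|have df := db m x].
    have := @is_deriveZ _ _ _ P (P 0)^-1 x 1 _ df; exact.
  have := @is_deriveZ _ _ _ (b m) (P 0)^-1 x 1 _ df; exact.
- case: m => [|m].
    exists 1 => x; rewrite /F ger0_norm; last first.
      by rewrite mulr_ge0 ?invr_ge0 ?(ltW P0_gt0)// /P Rintegral_ge0.
    rewrite ler_pdivrMl// mulr1.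
    have [x0|x0] := leP 0 x; first by rewrite P0.
    have [c _ Ec] := Pmvt _ _ x0.
    by rewrite -subr_ge0 Ec mulr_ge0// subr_ge0 ltW.
  have [C bC] := flat_bounded (iter m flat_next (1, 0%N)).
  exists ((P 0)^-1 * C) => x; rewrite /F normrM ger0_norm ?invr_ge0 ?(ltW P0_gt0)//.
  by rewrite ler_wpM2l ?invr_ge0 ?(ltW P0_gt0)//; exact: bC.
- by rewrite /F (P1 _ x1) mulr0.
- by rewrite /F (P0 _ x0) mulVf// gt_eqF.
- by rewrite /F mulr_ge0 ?invr_ge0 ?(ltW P0_gt0).
Qed.

End smooth_step.

(** * Lebesgue measure of rectangles *)

Section rectangles.
Context {R : realType}.
Local Open Scope ereal_scope.

Lemma measurable_fun_prode d (T : measurableType d) (I : Type) (s : seq I)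
    (P : pred I) (u : I -> T -> \bar R) :
  (forall i, measurable_fun setT (u i)) ->
  measurable_fun setT (fun x => \big[*%E/1]_(i <- s | P i) u i x).
Proof.
move=> mu; elim: s => [|i s IH].
  by under eq_fun do rewrite big_nil; exact: measurable_cst.
under eq_fun do rewrite big_cons.
by case: (P i) => //; exact: emeasurable_funM.
Qed.

(** Tonelli, one coordinate at a time along the recursive definition of the
    measure. Values are extended reals so that infinite integrals need no special
    treatment. *)
Lemma integral_tensor n (u : 'I_n -> R -> \bar R) :
  (forall i, measurable_fun setT (u i)) -> (forall i t, 0 <= u i t) ->
  \int[lebesgue_rV]_x \big[*%E/1]_(i < n) u i (x ord0 i) =
  \big[*%E/1]_(i < n) \int[lebesgue_measure]_t u i t.
Proof.
have prod_ge0 (I : finType) (v : I -> \bar R) : (forall i, 0 <= v i) ->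
    0 <= \big[*%E/1]_i v i.
  by move=> v0; elim/big_ind : _ => //; exact: mule_ge0.
elim: n u => [|n IH] u mu u0.
  under eq_integral do rewrite big_ord0.
  by rewrite big_ord0 integral_cst//= diracT mul1e.
have mc i : measurable_fun setT (fun x : 'rV[R]_n => u (lift ord0 i) (x ord0 i)).
  by apply: measurableT_comp => //; exact: measurable_rV_coord.
rewrite [lebesgue_rV]/=.
rewrite ge0_integral_pushforward//=.
- rewrite preimage_setT.
  under eq_integral => tx _.
    rewrite big_ord_recl row_cons_head.
    under eq_bigr do rewrite row_cons_tail.
    over.
  rewrite /= fubini_tonelli1//=; first last.
  + by move=> tx; apply: mule_ge0 => //; exact: prod_ge0.
  + apply: emeasurable_funM.
      exact: (measurableT_comp (mu ord0) measurable_fst).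
    exact: (measurableT_comp (measurable_fun_prode _ _ mc) measurable_snd).
  rewrite /fubini_F/=.
  under eq_integral => t _.
    rewrite ge0_integralZl//; last 2 first.
    + exact: measurable_fun_prode.
    + by move=> x _; exact: prod_ge0.
    rewrite (IH (fun i => u (lift ord0 i)))//; over.
  rewrite /= ge0_integralZr// ?big_ord_recl//.
    exact: (mu ord0).
  by apply: prod_ge0 => i; exact: integral_ge0.
- exact: measurable_row_cons.
- apply: measurable_fun_prode => i.
  by apply: measurableT_comp => //; exact: measurable_rV_coord.
- by move=> x _; exact: prod_ge0.
Qed.

Definition rectangle n (B : 'I_n -> set R) : set 'rV[R]_n :=
  [set x | forall i, B i (x ord0 i)].

Lemma measurable_rectangle n (B : 'I_n -> set R) :
  (forall i, measurable (B i)) -> measurable (rectangle B).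
Proof.
move=> mB; rewrite (_ : rectangle B =
    \big[setI/setT]_(i < n) (@rV_coord R n i @^-1` B i)).
  apply: bigsetI_measurable => i _; rewrite -[X in measurable X]setTI.
  exact: measurable_rV_coord.
rewrite -bigcap_seq/=; apply/seteqP; split => [x Bx i _ /=|x Bx i].
  exact: Bx.
by apply: (Bx i); rewrite /= mem_index_enum.
Qed.

Lemma lebesgue_rectangle n (B : 'I_n -> set R) :
  (forall i, measurable (B i)) ->
  lebesgue_rV (rectangle B) =
  \big[*%E/1]_(i < n) (lebesgue_measure : set R -> \bar R) (B i).
Proof.
move=> mB; have mR := measurable_rectangle mB.
rewrite -(setIT (rectangle B)) -integral_indic//.
transitivity (\int[lebesgue_rV]_x
    \big[*%E/1]_(i < n) (\1_(B i) (x ord0 i))%:E).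
  apply: eq_integral => x _.
  rewrite prodEFin; congr EFin; rewrite indicE.
  case: (boolP (x \in rectangle B)) => [|xB].
    by rewrite inE => xB; rewrite big1// => i _; rewrite indicE mem_set.
  apply/esym/eqP/prodf_eq0; apply: contrapT => H; move/negP: xB; apply.
  rewrite inE => i; apply: contrapT => Bi; apply: H; exists i => //.
  by rewrite indicE memNset.
rewrite (integral_tensor (u := fun i t => (\1_(B i) t)%:E))//.
  by apply: eq_bigr => i _; rewrite integral_indic ?setIT//; exact: mB.
by move=> i; apply/measurable_EFinP; exact: measurable_indic.
Qed.

(** Rectangles with arbitrary Borel sides form a pi-system that generates the
    sigma-algebra of coordinates; the cubes [[-k, k]^n] exhaust the space. *)
Lemma lebesgue_rV_unique n (m : {measure set 'rV[R]_n -> \bar R}) :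
  (forall B : 'I_n -> set R, (forall i, measurable (B i)) ->
    m (rectangle B) = \big[*%E/1]_(i < n) (lebesgue_measure : set R -> \bar R) (B i)) ->
  forall A, measurable A -> m A = lebesgue_rV A.
Proof.
move=> mE A mA.
pose G := [set rectangle B | B in [set B : 'I_n -> set R | forall i, measurable (B i)]].
pose g (k : nat) : set 'rV[R]_n := rectangle (fun=> `[(- k%:R)%R, k%:R%R]%classic).
apply/esym.
apply: (@measure_unique _ R _ G g _ _ _ _ lebesgue_rV m _ _ A mA).
- apply/seteqP; split.
    apply: smallest_sub; first exact: smallest_sigma_algebra.
    rewrite -bigcup_seq/=; apply: bigcup_sub => i _ C [B mB <-].
    apply: sub_sigma_algebra; exists (fun j => if j == i then B else setT).
      by move=> j /=; case: ifP.
    rewrite setTI; apply/seteqP; split => x /=.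
      by move=> /(_ i); rewrite eqxx.
    by move=> Bx j; case: eqP => // ->.
  apply: smallest_sub; first exact: sigma_algebra_measurable.
  by move=> _ [B mB <-]; exact: measurable_rectangle.
- move=> _ _ [B mB <-] [C mC <-]; exists (fun i => B i `&` C i).
    by move=> i /=; exact: measurableI.
  apply/seteqP; split => [x BCx|x [Bx Cx] i].
    by split=> i; case: (BCx i).
  by split; [exact: Bx|exact: Cx].
- by move=> k; exists (fun=> `[(- k%:R)%R, k%:R%R]%classic).
- apply/seteqP; split => // x _.
  pose k := (\max_(i < n) Num.bound `|x ord0 i|)%N.
  exists k => // i /=; rewrite in_itv/= -ler_norml.
  rewrite (le_trans (ltW (archi_boundP _)))// ?normr_ge0//.
  by rewrite ler_nat; exact: (leq_bigmax (F := fun i => Num.bound `|x ord0 i|%R) i).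
- by move=> _ [B mB <-]; rewrite [RHS]mE//; exact: lebesgue_rectangle.
- move=> k; rewrite /g.
  have := @lebesgue_rectangle n (fun=> `[(- k%:R)%R, k%:R%R]%classic) (fun=> measurable_itv _).
  move=> /= ->.
  suff : \big[*%E/1]_(i < n) (lebesgue_measure : set R -> \bar R)
      `[(- k%:R)%R, k%:R%R]%classic \is a fin_num by rewrite fin_numElt => /andP[].
  elim/big_ind : _ => // [x y|i _]; first exact: fin_numM.
  rewrite lebesgue_measure_itv/=; case: ifP => //.
Qed.
End rectangles.

(** * Exchanging and splitting coordinates *)

Section measure_preserving.
Context {R : realType}.
Local Open Scope ereal_scope.

Section transfer.
Context d1 d2 (X : measurableType d1) (Y : measurableType d2).
Variables (mu : {measure set X -> \bar R}) (nu : {measure set Y -> \bar R}).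
Variable phi : X -> Y.
Hypothesis mphi : measurable_fun setT phi.
Hypothesis phiE : forall A, measurable A -> mu (phi @^-1` A) = nu A.

Lemma ge0_integral_transfer (f : Y -> \bar R) :
  measurable_fun setT f -> (forall y, 0 <= f y) ->
  \int[nu]_y f y = \int[mu]_x f (phi x).
Proof.
move=> mf f0.
transitivity (\int[pushforward mu phi]_y f y).
  by apply: eq_measure_integral => A mA _; apply/esym; exact: phiE.
by rewrite ge0_integral_pushforward.
Qed.

Lemma integral_transfer (f : Y -> \bar R) : measurable_fun setT f ->
  \int[nu]_y f y = \int[mu]_x f (phi x).
Proof.
move=> mf; rewrite integralE [RHS]integralE.
congr (_ - _).
  rewrite (ge0_integral_transfer (measurable_funepos mf) (funepos_ge0 f)).
  by apply: eq_integral => x _; rewrite !funeposE.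
rewrite (ge0_integral_transfer (measurable_funeneg mf) (funeneg_ge0 f)).
by apply: eq_integral => x _; rewrite !funenegE.
Qed.

End transfer.

Lemma measurable_preimage d1 d2 (X : measurableType d1) (Y : measurableType d2)
  (phi : X -> Y) : measurable_fun setT phi ->
  forall A, measurable A -> measurable (phi @^-1` A).
Proof. by move=> mphi A mA; rewrite -[X in measurable X]setTI; exact: mphi. Qed.

Definition permute_rV n (s : {perm 'I_n}) (x : 'rV[R]_n) : 'rV[R]_n :=
  \row_i x ord0 (s i).

Lemma measurable_permute_rV n (s : {perm 'I_n}) : measurable_fun setT (permute_rV s).
Proof.
apply: measurable_fun_rV => i.
rewrite (_ : _ \o _ = @rV_coord R n (s i)); first exact: measurable_rV_coord.
by apply/funext => x; rewrite /= /rV_coord mxE.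
Qed.

Lemma lebesgue_permute_rV n (s : {perm 'I_n}) (A : set 'rV[R]_n) : measurable A ->
  lebesgue_rV (permute_rV s @^-1` A) = lebesgue_rV A.
Proof.
move=> mA.
pose mS := isMeasurableFun.Build _ _ _ _ _ (measurable_permute_rV s).
pose S : {mfun 'rV[R]_n >-> 'rV[R]_n} := HB.pack (permute_rV s) mS.
apply: (lebesgue_rV_unique (m := pushforward lebesgue_rV S)) => // B mB.
rewrite /= /pushforward /=.
rewrite (_ : _ @^-1` _ = rectangle (fun i => B ((s^-1)%g i))); last first.
  apply/seteqP; split => x /= Bx i.
    by have := Bx ((s^-1)%g i); rewrite mxE permKV.
  by rewrite mxE -{1}(permK s i); exact: Bx.
rewrite lebesgue_rectangle// [RHS](reindex_inj (@perm_inj _ (s^-1)%g)).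
by [].
Qed.

Definition row_uncons n (z : 'rV[R]_n.+1) : measurableTypeR R * 'rV[R]_n :=
  (z ord0 ord0, \row_i z ord0 (lift ord0 i)).

Lemma row_consK n : cancel (@row_cons R n) (@row_uncons n).
Proof.
move=> [t x]; rewrite /row_uncons row_cons_head; congr (_, _).
by apply/rowP => i; rewrite mxE row_cons_tail.
Qed.

Lemma measurable_row_uncons n : measurable_fun setT (@row_uncons n).
Proof.
apply: measurable_fun_pair.
  exact: (@measurable_rV_coord R n.+1 ord0).
apply: measurable_fun_rV => i.
rewrite (_ : _ \o _ = @rV_coord R n.+1 (lift ord0 i)).
  exact: measurable_rV_coord.
by apply/funext => x /=; rewrite /rV_coord mxE.
Qed.

(** The involution of [R * R^n] that exchanges the first component with the
    coordinate [i]. Fubini for the coordinate [i] reduces to its invariance. *)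
Definition swap_coord n (i : 'I_n) (tx : measurableTypeR R * 'rV[R]_n) :
  measurableTypeR R * 'rV[R]_n := (tx.2 ord0 i, update_rV i tx.2 tx.1).

Lemma swap_coordE n (i : 'I_n) tx :
  swap_coord i tx = row_uncons (permute_rV (tperm ord0 (lift ord0 i)) (row_cons tx)).
Proof.
case: tx => t x; rewrite /swap_coord /row_uncons /=; congr (_, _).
  by rewrite mxE tpermL row_cons_tail.
apply/rowP => j; rewrite [LHS]mxE [RHS]mxE [RHS]mxE; case: eqVneq => [->|ji].
  by rewrite tpermR row_cons_head.
rewrite tpermD ?row_cons_tail ?neq_lift//.
by rewrite (inj_eq lift_inj) eq_sym.
Qed.

Lemma measurable_swap_coord n (i : 'I_n) : measurable_fun setT (swap_coord i).
Proof.
rewrite (_ : swap_coord i =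
    @row_uncons n \o permute_rV (tperm ord0 (lift ord0 i)) \o @row_cons R n).
  apply: measurableT_comp; last exact: measurable_row_cons.
  apply: measurableT_comp; [exact: measurable_row_uncons|exact: measurable_permute_rV].
by apply/funext => tx; rewrite swap_coordE.
Qed.

(** Under the identification of [R * R^n] with [R^(n+1)] the exchange becomes a
    transposition of coordinates. *)
Lemma lebesgue_swap_coord n (i : 'I_n) A : measurable A ->
  (lebesgue_measure \x lebesgue_rV) (swap_coord i @^-1` A) =
  (lebesgue_measure \x (lebesgue_rV : set 'rV[R]_n -> \bar R)) A.
Proof.
move=> mA; set m := _ \x _.
have mA' := measurable_preimage (@measurable_row_uncons n) mA.
transitivity (lebesgue_rV (permute_rV (tperm ord0 (lift ord0 i)) @^-1` (@row_uncons n @^-1` A))).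
  rewrite [RHS]/= /cons_measure /pushforward; congr (m _).
  by apply/funext => tx; rewrite /preimage/= swap_coordE.
rewrite lebesgue_permute_rV//= /cons_measure /pushforward; congr (m _).
by apply/funext => tx; rewrite /preimage/= row_consK.
Qed.

Definition merge_pair n (I : {set 'I_n}) (ut : 'rV[R]_#|~: I| * 'rV[R]_#|I|) : 'rV[R]_n :=
  merge_rV ut.1 ut.2.

Lemma merge_rV_in n (I : {set 'I_n}) u t (k : 'I_#|I|) :
  (merge_rV (R:=R) u t) ord0 (enum_val k) = t ord0 k.
Proof.
rewrite mxE (big_pred1 k) => [|j]; last by rewrite /= (inj_eq enum_val_inj).
rewrite big_pred0 ?addr0// => j; apply/negbTE/eqP => jk.
by have := enum_valP j; rewrite jk finset.in_setC (enum_valP k).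
Qed.

Lemma merge_rV_notin n (I : {set 'I_n}) u t (k : 'I_#|~: I|) :
  (merge_rV (R:=R) u t) ord0 (enum_val k) = u ord0 k.
Proof.
rewrite mxE [X in (_ + X)%R](big_pred1 k) => [|j]; last by rewrite /= (inj_eq enum_val_inj).
rewrite big_pred0 ?add0r// => j; apply/negbTE/eqP => jk.
by have := enum_valP k; rewrite -jk finset.in_setC (enum_valP j).
Qed.

Lemma forall_merge n (I : {set 'I_n}) (P : 'I_n -> Prop) :
  (forall i, P i) <->
  (forall k : 'I_#|~: I|, P (enum_val k)) /\ (forall k : 'I_#|I|, P (enum_val k)).
Proof.
split => [H|[HC H] i]; first by split.
case: (boolP (i \in I)) => iI; first by rewrite -(enum_rankK_in iI iI).
have iC : i \in ~: I by rewrite finset.in_setC.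
by rewrite -(enum_rankK_in iC iC).
Qed.

Lemma measurable_merge n (I : {set 'I_n}) : measurable_fun setT (@merge_pair n I).
Proof.
apply: measurable_fun_rV => i; move: i.
apply/(forall_merge I); split => k.
  rewrite (_ : _ \o _ = @rV_coord R _ k \o fst).
    exact: measurableT_comp (measurable_rV_coord _) measurable_fst.
  by apply/funext => ut; rewrite /= /rV_coord /merge_pair merge_rV_notin.
rewrite (_ : _ \o _ = @rV_coord R _ k \o snd).
  exact: measurableT_comp (measurable_rV_coord _) measurable_snd.
by apply/funext => ut; rewrite /= /rV_coord /merge_pair merge_rV_in.
Qed.

(** Both sides give a rectangle the product of the lengths of its sides, grouped
    differently. *)
Lemma lebesgue_merge n (I : {set 'I_n}) (A : set 'rV[R]_n) : measurable A ->
  (lebesgue_rV \x lebesgue_rV) (@merge_pair n I @^-1` A) = lebesgue_rV A.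
Proof.
move=> mA.
pose mS := isMeasurableFun.Build _ _ _ _ _ (@measurable_merge n I).
pose S : {mfun _ >-> 'rV[R]_n} := HB.pack (@merge_pair n I) mS.
apply: (lebesgue_rV_unique (m := pushforward (lebesgue_rV \x lebesgue_rV) S)) => // B mB.
rewrite /= /pushforward /=.
rewrite (_ : _ @^-1` _ = rectangle (fun k : 'I_#|~: I| => B (enum_val k)) `*`
    rectangle (fun k : 'I_#|I| => B (enum_val k))); last first.
  apply/seteqP; split => -[u t] /=.
    move/(forall_merge I) => [HC H]; split => k.
      by have := HC k; rewrite /merge_pair merge_rV_notin.
    by have := H k; rewrite /merge_pair merge_rV_in.
  move=> [Hu Ht]; apply/(forall_merge I); split => k.
    by rewrite /merge_pair merge_rV_notin; exact: Hu.
  by rewrite /merge_pair merge_rV_in; exact: Ht.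
rewrite product_measure1E; [|exact: measurable_rectangle|exact: measurable_rectangle].
pose F i := (lebesgue_measure : set R -> \bar R) (B i).
transitivity (\big[*%E/1]_(k < #|~: I|) F (enum_val k) *
              \big[*%E/1]_(k < #|I|) F (enum_val k)).
  by congr (_ * _); apply: lebesgue_rectangle.
have E (J : {set 'I_n}) :
    \big[*%E/1]_(k < #|J|) F (enum_val k) = \big[*%E/1]_(i in J) F i.
  by rewrite -big_enum_val.
rewrite (E (~: I)) (E I) [RHS](bigID (mem (~: I)))/=; congr (_ * _).
by apply: eq_bigl => i; rewrite /= finset.in_setC negbK.
Qed.

End measure_preserving.

(** * Restriction to boxes *)

Section restrictions.
Context {R : realType}.
Local Open Scope ereal_scope.

Lemma ge0_integral_mrestr d (T : measurableType d) (m : {measure set T -> \bar R})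
    (D : set T) (mD : measurable D) (f : T -> \bar R) :
  measurable_fun setT f -> (forall x, 0 <= f x) ->
  \int[mrestr m mD]_x f x = \int[m]_(x in D) f x.
Proof.
move=> mf f0.
rewrite (@ge0_negligible_integral _ _ _ (mrestr m mD) setT (~` D))//.
- rewrite setTD setCK; apply: eq_measure_integral => A mA AD.
  by rewrite /= /mrestr setIidl.
- exact: measurableC.
- by rewrite /= /mrestr setICl measure0.
Qed.

Lemma integral_mrestr d (T : measurableType d) (m : {measure set T -> \bar R})
    (D : set T) (mD : measurable D) (f : T -> \bar R) :
  measurable_fun setT f -> \int[mrestr m mD]_x f x = \int[m]_(x in D) f x.
Proof.
move=> mf; rewrite [LHS]integralE [RHS]integralE.
rewrite (ge0_integral_mrestr _ _ (measurable_funepos mf))//.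
by rewrite (ge0_integral_mrestr _ _ (measurable_funeneg mf)).
Qed.

Lemma box_rectangle n (a b : 'rV[R]_n) :
  box a b = rectangle (fun i => `[a ord0 i, b ord0 i]%classic).
Proof. by apply/seteqP; split => x /= xab i; have := xab i; rewrite /= in_itv. Qed.

Lemma box_measure_fin n (a b : 'rV[R]_n) : fin_num_fun (box_measure a b).
Proof.
move=> A mA; rewrite ge0_fin_numE// (@le_lt_trans _ _ (lebesgue_rV (box a b)))//.
  by rewrite /= /box_measure /mrestr le_measure ?inE//;
    [apply: measurableI => //; exact: measurable_box|exact: measurable_box].
rewrite box_rectangle.
have -> := @lebesgue_rectangle R n (fun i => `[a ord0 i, b ord0 i]%classic)
  (fun=> measurable_itv _).
suff : \big[*%E/1]_(i < n) (lebesgue_measure : set R -> \bar R)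
    `[a ord0 i, b ord0 i]%classic \is a fin_num by rewrite fin_numElt => /andP[].
elim/big_ind : _ => // [x y|i _]; first exact: fin_numM.
by rewrite lebesgue_measure_itv/=; case: ifP.
Qed.

HB.instance Definition _ n (a b : 'rV[R]_n) :=
  @Measure_isFinite.Build _ _ _ (box_measure a b) (@box_measure_fin n a b).

Definition segment_measure (u v : R) : set (measurableTypeR R) -> \bar R :=
  mrestr (@lebesgue_measure R) (measurable_itv `[u, v]).

HB.instance Definition _ u v := Measure.on (segment_measure u v).

Lemma segment_measureT u v : (u <= v)%R -> segment_measure u v setT = (v - u)%:E.
Proof.
move=> uv; rewrite /segment_measure /mrestr setTI lebesgue_measure_itv/= lte_fin.
case: ltP => [_|vu]; first by rewrite EFinB.
by rewrite (@le_anti _ _ u v) ?subrr// uv vu.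
Qed.

Lemma segment_measure_fin u v : fin_num_fun (segment_measure u v).
Proof.
move=> A mA; rewrite ge0_fin_numE//.
rewrite (@le_lt_trans _ _ (lebesgue_measure `[u, v]%classic))//.
  by rewrite /segment_measure /mrestr le_measure ?inE//; exact: measurableI.
by rewrite lebesgue_measure_itv/=; case: ifP => // _; rewrite ltry.
Qed.

HB.instance Definition _ u v :=
  @Measure_isFinite.Build _ _ _ (segment_measure u v) (@segment_measure_fin u v).

Lemma product_mrestr d1 d2 (X : measurableType d1) (Y : measurableType d2)
    (m1 : {sigma_finite_measure set X -> \bar R})
    (m2 : {sigma_finite_measure set Y -> \bar R})
    (n1 : {sigma_finite_measure set X -> \bar R})
    (n2 : {sigma_finite_measure set Y -> \bar R})
    (D : set X) (E : set Y) : measurable D -> measurable E ->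
  (forall A, n1 A = m1 (A `&` D)) -> (forall A, n2 A = m2 (A `&` E)) ->
  forall A, measurable A -> (n1 \x n2) A = (m1 \x m2) (A `&` (D `*` E)).
Proof.
move=> mD mE n1E n2E A mA; have mDE := measurableX mD mE.
apply: (@product_measure_unique _ _ _ _ R n1 n2 (mrestr (m1 \x m2) mDE)) => // B C mB mC.
rewrite /= /mrestr -setXI product_measure1E; [|exact: measurableI|exact: measurableI].
by rewrite n1E n2E.
Qed.

Lemma box_swap_coord n (a b : 'rV[R]_n) (i : 'I_n) A : measurable A ->
  (segment_measure (a ord0 i) (b ord0 i) \x box_measure a b) (swap_coord i @^-1` A) =
  (segment_measure (a ord0 i) (b ord0 i) \x box_measure a b) A.
Proof.
move=> mA; have mS := measurable_preimage (measurable_swap_coord i) mA.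
have mab := measurable_itv `[a ord0 i, b ord0 i].
have mbox := measurable_box a b.
pose E := product_mrestr (m1 := @lebesgue_measure R) (m2 := lebesgue_rV)
  (n1 := segment_measure (a ord0 i) (b ord0 i)) (n2 := box_measure a b) mab mbox
   (fun=> erefl) (fun=> erefl).
rewrite (E _ mS) (E _ mA).
rewrite -[RHS](lebesgue_swap_coord i); last first.
  by apply: measurableI => //; exact: measurableX.
congr (product_measure1 _ _); apply/seteqP; split => -[t x] /= [Atx].
  rewrite !in_itv/= => -[tab xab]; split => //; split; first exact: xab.
  by move=> j; rewrite mxE; case: eqP => [->//|_]; exact: xab.
rewrite !in_itv/= => -[xi xab]; split => //; split.
  by have := xab i; rewrite mxE eqxx.
move=> j; case: (eqVneq j i) => [->//|ji].
by have := xab j; rewrite mxE (negbTE ji).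
Qed.

Lemma box_merge n (a b : 'rV[R]_n) (I : {set 'I_n}) A : measurable A ->
  (box_measure (proj_rV (~: I) a) (proj_rV (~: I) b) \x
    box_measure (proj_rV I a) (proj_rV I b)) (@merge_pair R n I @^-1` A) =
  box_measure a b A.
Proof.
move=> mA; have mS := measurable_preimage (@measurable_merge R n I) mA.
pose E := (product_mrestr (m1 := lebesgue_rV) (m2 := lebesgue_rV)
  (n1 := box_measure (proj_rV (~: I) a) (proj_rV (~: I) b))
  (n2 := box_measure (proj_rV I a) (proj_rV I b))
  (measurable_box (proj_rV (~: I) a) (proj_rV (~: I) b))
  (measurable_box (proj_rV I a) (proj_rV I b)) (fun=> erefl) (fun=> erefl)).
rewrite (E _ mS) /box_measure /mrestr -(@lebesgue_merge R n I); last first.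
  by apply: measurableI => //; exact: measurable_box.
congr (product_measure1 _ _); apply/seteqP; split => -[u t] /= [Aut].
  move=> [uab tab]; split => //; apply/(forall_merge I); split => k.
    by rewrite /merge_pair merge_rV_notin; have := uab k; rewrite !mxE.
  by rewrite /merge_pair merge_rV_in; have := tab k; rewrite !mxE.
move/(forall_merge I) => [HC H]; split => //; split => k.
  by rewrite !mxE; have := HC k; rewrite /merge_pair merge_rV_notin.
by rewrite !mxE; have := H k; rewrite /merge_pair merge_rV_in.
Qed.

Section null_sections.
Context d1 d2 (X : measurableType d1) (Y : measurableType d2).
Variables (m1 : {sigma_finite_measure set X -> \bar R}).
Variables (m2 : {sigma_finite_measure set Y -> \bar R}).

Lemma null_xsection N : measurable N -> (m1 \x m2) N = 0 ->
  \forall x \ae m1, m2 (xsection N x) = 0.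
Proof.
move=> mN N0.
have mf : measurable_fun setT (m2 \o xsection N) by exact: measurable_fun_xsection.
have /(ae_eq_integral_abs m1 measurableT mf) : \int[m1]_x `|(m2 \o xsection N) x| = 0.
  by rewrite -[RHS]N0; apply: eq_integral => x _; rewrite gee0_abs.
by apply: filterS => x /(_ Logic.I).
Qed.

Lemma null_ysection N : measurable N -> (m1 \x m2) N = 0 ->
  \forall y \ae m2, m1 (ysection N y) = 0.
Proof.
move=> mN N0.
have mf : measurable_fun setT (m1 \o ysection N) by exact: measurable_fun_ysection.
have /(ae_eq_integral_abs m2 measurableT mf) : \int[m2]_x `|(m1 \o ysection N) x| = 0.
  rewrite -[RHS]N0 (@product_measure_unique _ _ _ _ R m1 m2 (m1 \x^ m2))//.
    by apply: eq_integral => x _; rewrite gee0_abs.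
  by move=> A B mA mB; exact: product_measure2E.
by apply: filterS => x /(_ Logic.I).
Qed.

End null_sections.
End restrictions.

(** * Bounded Borel functions *)

Definition bounded_borel {R : realType} d (T : measurableType d) (f : T -> R) :=
  measurable_fun setT f /\ exists M : R, forall x, `|f x| <= M.

Section bounded_borel.
Context {R : realType} d (T : measurableType d).
Implicit Types f g : T -> R.

Lemma bounded_borelB f g :
  bounded_borel f -> bounded_borel g -> bounded_borel (f \- g).
Proof.
move=> [mf [M fM]] [mg [N gN]]; split; first exact: measurable_funB.
by exists (M + N) => x; rewrite (le_trans (ler_normB _ _))// lerD.
Qed.

Lemma bounded_borelM f g :
  bounded_borel f -> bounded_borel g -> bounded_borel (fun x => f x * g x).
Proof.
move=> [mf [M fM]] [mg [N gN]]; split; first exact: measurable_funM.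
by exists (M * N) => x; rewrite normrM ler_pM.
Qed.

Lemma bounded_borel_comp d' (U : measurableType d') f (h : U -> T) :
  bounded_borel f -> measurable_fun setT h -> bounded_borel (f \o h).
Proof.
by move=> [mf [M fM]] mh; split; [exact: measurableT_comp|exists M => x; exact: fM].
Qed.

Lemma bounded_borel_integrable_fin (m : {measure set T -> \bar R}) f :
  (m setT < +oo)%E -> bounded_borel f -> m.-integrable setT (EFin \o f).
Proof.
move=> moo [mf [M fM]].
apply: (@le_integrable _ _ _ m setT measurableT _ (EFin \o cst M)).
- exact/measurable_EFinP.
- by move=> x _; rewrite /= lee_fin (le_trans (fM x))// ler_norm.
- apply/integrableP; split; first exact/measurable_EFinP.
  rewrite (eq_integral (cst `|M|%:E))// integral_cst//.
  by rewrite lte_mul_pinfty// lee_fin.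
Qed.

Lemma bounded_borel_integrable (m : {finite_measure set T -> \bar R}) f :
  bounded_borel f -> m.-integrable setT (EFin \o f).
Proof.
by apply: bounded_borel_integrable_fin; rewrite -ge0_fin_numE// fin_num_measure.
Qed.

Lemma integrable_mul_bounded (m : {measure set T -> \bar R}) f g (M : R) :
  m.-integrable setT (EFin \o f) -> measurable_fun setT g ->
  (forall x, `|g x| <= M) -> m.-integrable setT (EFin \o (fun x => f x * g x)).
Proof.
move=> intf mg gM; have M0 : 0 <= M := le_trans (normr_ge0 _) (gM point).
apply: (@le_integrable _ _ _ m setT measurableT _ (fun x => (M%:E * (f x)%:E)%E)).
- apply/measurable_EFinP; apply: measurable_funM => //.
  by apply/measurable_EFinP; exact: measurable_int intf.
- move=> x _; rewrite /= lee_fin !normrM mulrC ler_wpM2r//.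
  by rewrite (ger0_norm M0).
- exact: (integrableZl measurableT M intf).
Qed.

End bounded_borel.

Lemma bounded_borel_integrable_prod {R : realType} d1 d2 (X : measurableType d1)
    (Y : measurableType d2) (m1 : {finite_measure set X -> \bar R})
    (m2 : {finite_measure set Y -> \bar R}) (f : X * Y -> R) :
  bounded_borel f -> (m1 \x m2)%E.-integrable setT (EFin \o f).
Proof.
apply: bounded_borel_integrable_fin.
have := product_measure1E m1 m2 (@measurableT _ X) (@measurableT _ Y).
rewrite setXTT => E; rewrite [X in (X < _)%E]E.
by rewrite lte_mul_pinfty// ?fin_num_measure// -ge0_fin_numE// fin_num_measure.
Qed.

(** * Coordinate means and mixed projections *)

Section coordinate_means.
Context {R : realType} {d : nat}.
Variables (a b : 'rV[R]_d).
Hypothesis ab : forall i, a ord0 i < b ord0 i.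
Implicit Types (I : {set 'I_d}) (i j : 'I_d) (phi w : 'rV[R]_d -> R).

Local Notation seg i := (segment_measure (a ord0 i) (b ord0 i)).
Local Notation mu := (box_measure a b).

Lemma measurable_update i (x : 'rV[R]_d) :
  measurable_fun setT (fun t : measurableTypeR R => update_rV i x t).
Proof.
apply: measurable_fun_rV => j; case: (eqVneq j i) => [->|ji].
  rewrite (_ : _ \o _ = id); first exact: measurable_id.
  by apply/funext => t; rewrite /= /rV_coord mxE eqxx.
rewrite (_ : _ \o _ = cst (x ord0 j)); first exact: measurable_cst.
by apply/funext => t; rewrite /= /rV_coord mxE (negbTE ji).
Qed.

Lemma coord_meanE i phi x : measurable_fun setT phi ->
  coord_mean a b i phi x =
  (b ord0 i - a ord0 i)^-1 * \int[seg i]_t phi (update_rV i x t).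
Proof.
move=> mphi; rewrite /coord_mean /Rintegral integral_mrestr//.
by apply/measurable_EFinP; exact: (measurableT_comp mphi (measurable_update i x)).
Qed.

Lemma measurable_coord_mean i phi : measurable_fun setT phi ->
  measurable_fun setT (coord_mean a b i phi).
Proof.
move=> mphi.
pose K (tx : measurableTypeR R * 'rV[R]_d) := (phi (swap_coord i tx).2)%:E.
have mK : measurable_fun setT K.
  apply/measurable_EFinP; apply: (measurableT_comp mphi).
  exact: (measurableT_comp measurable_snd (measurable_swap_coord i)).
rewrite (_ : coord_mean _ _ _ _ = fun x => (b ord0 i - a ord0 i)^-1 *
    fine (\int[seg i]_t K^\+ (t, x) - \int[seg i]_t K^\- (t, x))); last first.
  apply/funext => x; rewrite coord_meanE// /Rintegral integralE.
  congr (_ * fine (_ - _)); apply: eq_integral => t _.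
    by rewrite !funeposE.
  by rewrite !funenegE.
apply: measurable_funM => //.
apply: (@measurableT_comp _ _ _ _ _ _ fine) => //.
apply: emeasurable_funB.
  exact:  (measurable_fun_fubini_tonelli_G (m1 := seg i) _ (measurable_funepos mK) (funepos_ge0 K)).
exact: (measurable_fun_fubini_tonelli_G (m1 := seg i) _ (measurable_funeneg mK) (funeneg_ge0 K)).
Qed.

Lemma bounded_borel_coord_mean i phi : bounded_borel phi ->
  bounded_borel (coord_mean a b i phi).
Proof.
move=> bphi; have [mphi [M phiM]] := bphi.
split; first exact: measurable_coord_mean.
have ba : 0 < b ord0 i - a ord0 i by rewrite subr_gt0.
exists M => x.
have bu : bounded_borel (fun t : measurableTypeR R => phi (update_rV i x t)).
  exact: (bounded_borel_comp bphi (measurable_update i x)).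
rewrite coord_meanE// normrM ger0_norm ?invr_ge0 ?(ltW ba)// ler_pdivrMl//.
apply: (le_trans (le_normr_Rintegral _ (bounded_borel_integrable _ bu)))=> //.
have bn : bounded_borel (fun t : measurableTypeR R => `|phi (update_rV i x t)|).
  case: bu => [mu' _]; split; first exact: measurableT_comp.
  by exists M => t; rewrite normr_id.
apply: (le_trans (@le_Rintegral _ _ _ _ _ _ (cst M) _ (bounded_borel_integrable _ bn) _ _)) => //.
  by apply: bounded_borel_integrable; split => //; exists `|M| => t.
by rewrite Rintegral_cst// [X in fine X](segment_measureT (ltW (ab i)))/= mulrC.
Qed.

(** A null set stays null when one coordinate is replaced by an independent
    variable, because [box_swap_coord] turns its preimage into a product with a
    null set. *)
Lemma ae_update i (P : set 'rV[R]_d) : measurable P ->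
  (\forall x \ae mu, P x) ->
  \forall x \ae mu, \forall t \ae seg i, P (update_rV i x t).
Proof.
move=> mP [N [mN N0 PN]].
pose m := (seg i \x mu)%E.
have m0 : m (swap_coord i @^-1` (setT `*` N)) = 0%E.
  rewrite /m box_swap_coord; last exact: measurableX.
  by rewrite product_measure1E// [X in (_ * X)%E]N0 mule0.
have mS := measurable_preimage (measurable_swap_coord i)
  (measurableX (@measurableT _ (measurableTypeR R)) mN).
apply: filterS (null_ysection mS m0) => x Nx.
exists (ysection (swap_coord i @^-1` (setT `*` N)) x); split => //.
- exact: measurable_ysection.
- move=> t Pt; rewrite /ysection /= inE/=; split => //.
  by apply: PN.
Qed.

Lemma ae_coord_mean i phi psi :
  measurable_fun setT phi -> measurable_fun setT psi ->
  (\forall x \ae mu, phi x = psi x) ->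
  \forall x \ae mu, coord_mean a b i phi x = coord_mean a b i psi x.
Proof.
move=> mphi mpsi.
have mE : measurable [set x | phi x = psi x].
  rewrite (_ : [set _ | _] = [set x | phi x == psi x]).
    rewrite -[X in measurable X]setTI.
    exact: measurable_fun_eqr.
  by apply/seteqP; split => x /= /eqP.
move/(ae_update (P := [set x | phi x = psi x]) i mE).
apply: filterS => x H; rewrite !coord_meanE//; congr (_ * fine _).
apply: ae_eq_integral => //.
- by apply/measurable_EFinP; exact: (measurableT_comp mphi (measurable_update i x)).
- by apply/measurable_EFinP; exact: (measurableT_comp mpsi (measurable_update i x)).
- move: H; apply: filterS; first exact: (ae_filter_ringOfSetsType (seg i)).
  by move=> t /= ->.
Qed.

Lemma Rintegral_box_seg i (K : measurableTypeR R * 'rV[R]_d -> R) : bounded_borel K ->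
  \int[mu]_x (\int[seg i]_t K (t, x)) = \int[(seg i \x mu)%E]_z K z.
Proof.
move=> bK; have iK := @bounded_borel_integrable_prod _ _ _ _ _ (seg i) mu _ bK.
rewrite /Rintegral -(integral21_prod_meas1 iK); congr fine.
apply: eq_integral => x _; rewrite fineK//.
have : bounded_borel (fun t : measurableTypeR R => K (t, x)).
  by apply: (bounded_borel_comp bK); exact: pair2_measurable.
move/(bounded_borel_integrable (seg i)) => /integrable_fin_num; exact.
Qed.

(** Both sides are integrals over a side of the box times the box, and they are
    carried to each other by [swap_coord]. *)
Lemma coord_mean_adjoint i phi w : bounded_borel phi -> bounded_borel w ->
  \int[mu]_x (coord_mean a b i phi x * w x) = \int[mu]_x (phi x * coord_mean a b i w x).
Proof.
move=> bphi bw; have [mphi _] := bphi; have [mw _] := bw.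
pose c := (b ord0 i - a ord0 i)^-1.
have bX (f : 'rV[R]_d -> R) : bounded_borel f ->
    bounded_borel (fun tx : measurableTypeR R * 'rV[R]_d => f tx.2).
  by move=> bf; exact: (bounded_borel_comp bf measurable_snd).
have bU (f : 'rV[R]_d -> R) : bounded_borel f ->
    bounded_borel (fun tx : measurableTypeR R * 'rV[R]_d => f (update_rV i tx.2 tx.1)).
  move=> bf; apply: (bounded_borel_comp bf).
  exact: (measurableT_comp measurable_snd (measurable_swap_coord i)).
have bT (f : 'rV[R]_d -> R) x : bounded_borel f ->
    bounded_borel (fun t : measurableTypeR R => f (update_rV i x t)).
  by move=> bf; exact: (bounded_borel_comp bf (measurable_update i x)).
have bc : bounded_borel (fun _ : measurableTypeR R * 'rV[R]_d => c).
  by split => //; exists `|c|.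
pose K (tx : measurableTypeR R * 'rV[R]_d) := c * (phi (update_rV i tx.2 tx.1) * w tx.2).
have bK : bounded_borel K.
  by apply: bounded_borelM => //; apply: bounded_borelM; [exact: bU|exact: bX].
pose L (tx : measurableTypeR R * 'rV[R]_d) := c * (phi tx.2 * w (update_rV i tx.2 tx.1)).
have bL : bounded_borel L.
  by apply: bounded_borelM => //; apply: bounded_borelM; [exact: bX|exact: bU].
have bl (f : 'rV[R]_d -> R) (r : R) x : bounded_borel f ->
    c * \int[seg i]_t f (update_rV i x t) * r =
    \int[seg i]_t (c * (f (update_rV i x t) * r)).
  move=> bf; have bfx := bT f x bf.
  rewrite -mulrA -RintegralZr//; last exact: (bounded_borel_integrable (seg i) bfx).
  rewrite RintegralZl//; apply: (bounded_borel_integrable (seg i)).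
  by apply: (bounded_borelM bfx); split => //; exists `|r|.
transitivity (\int[(seg i \x mu)%E]_z K z).
  rewrite -Rintegral_box_seg//; apply: eq_Rintegral => x _.
  by rewrite coord_meanE// bl.
transitivity (\int[(seg i \x mu)%E]_z L z); last first.
  rewrite -Rintegral_box_seg//; apply: eq_Rintegral => x _.
  rewrite coord_meanE// mulrC bl//; apply: eq_Rintegral => t _.
  by rewrite /L /= [phi x * _]mulrC.
rewrite /Rintegral; congr fine.
rewrite (integral_transfer (measurable_swap_coord i) (box_swap_coord a b i))//.
  apply: eq_integral => -[t x] _; congr EFin; rewrite /K /L /=.
  congr (c * (phi _ * _)); apply/rowP => j; rewrite !mxE.
  by case: eqVneq => [->|//]; rewrite ?eqxx.
by apply/measurable_EFinP; case: bK.
Qed.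

Lemma mixed_projE I phi : mixed_proj a b I phi =
  foldr (fun i chi => chi \- coord_mean a b i chi) phi [seq i <- index_enum 'I_d | i \in I].
Proof.
rewrite /mixed_proj -big_filter; elim: [seq _ <- _ | _] => [|i s IH].
  by rewrite big_nil.
by rewrite big_cons /= IH.
Qed.

Lemma measurable_mixed_proj I phi : measurable_fun setT phi ->
  measurable_fun setT (mixed_proj a b I phi).
Proof.
move=> mphi; rewrite mixed_projE; elim: [seq _ <- _ | _] => [|i s IH] //=.
by apply: measurable_funB => //; exact: measurable_coord_mean.
Qed.

Lemma bounded_borel_mixed_proj I phi : bounded_borel phi ->
  bounded_borel (mixed_proj a b I phi).
Proof.
move=> bphi; rewrite mixed_projE; elim: [seq _ <- _ | _] => [|i s IH] //=.
by apply: bounded_borelB => //; exact: bounded_borel_coord_mean.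
Qed.

(** The operators act on functions, not on classes: this is what allows [phi] to be
    replaced by a bounded representative. *)
Lemma ae_mixed_proj I phi psi :
  measurable_fun setT phi -> measurable_fun setT psi ->
  (\forall x \ae mu, phi x = psi x) ->
  \forall x \ae mu, mixed_proj a b I phi x = mixed_proj a b I psi x.
Proof.
move=> mphi mpsi E; rewrite !mixed_projE.
set s := [seq _ <- _ | _].
have m chi : measurable_fun setT chi -> forall s, measurable_fun setT
    (foldr (fun i chi => chi \- coord_mean a b i chi) chi s).
  move=> mchi; elim=> [|i u IH] //=.
  by apply: measurable_funB => //; exact: measurable_coord_mean.
elim: s => [|i s IH] //=.
have := ae_coord_mean i (m _ mphi s) (m _ mpsi s) IH.
by apply: filterS2 IH => x -> ->.
Qed.

(** Moving each factor [Id - Pi_j] onto [w] by self-adjointness keeps [w] independent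
    of the coordinate [i] until the factor [j = i], which then annihilates it. *)
Lemma mixed_proj_orthogonal I phi i w : bounded_borel phi -> bounded_borel w ->
  i \in I -> (forall x t, w (update_rV i x t) = w x) ->
  \int[mu]_x (mixed_proj a b I phi x * w x) = 0.
Proof.
move=> bphi bw iI; rewrite mixed_projE.
have : i \in [seq i <- index_enum 'I_d | i \in I] by rewrite mem_filter iI mem_index_enum.
elim: [seq _ <- _ | _] w bw => [//|j s IH] w bw ijs wi.
rewrite /=; set chi := foldr _ _ _.
have bchi : bounded_borel chi.
  rewrite /chi; elim: (s) => [|k u IHu] //=.
  by apply: bounded_borelB => //; exact: bounded_borel_coord_mean.
have bm (f : 'rV[R]_d -> R) : bounded_borel f -> bounded_borel (coord_mean a b j f).
  exact: bounded_borel_coord_mean.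
transitivity (\int[mu]_x (chi x * (w \- coord_mean a b j w) x)).
  have ib (f g : 'rV[R]_d -> R) : bounded_borel f -> bounded_borel g ->
      mu.-integrable setT (EFin \o (fun x => f x * g x)).
    by move=> bf bg; exact: (bounded_borel_integrable mu (bounded_borelM bf bg)).
  transitivity (\int[mu]_x (chi x * w x - coord_mean a b j chi x * w x)).
    by apply: eq_Rintegral => x _; rewrite /= -mulrBl.
  transitivity (\int[mu]_x (chi x * w x - chi x * coord_mean a b j w x)).
    by rewrite !RintegralB ?coord_mean_adjoint//; apply: ib => //; exact: bm.
  by apply: eq_Rintegral => x _; rewrite /= -mulrBr.
case: (eqVneq j i) => [ji|ji].
  have wj x : coord_mean a b j w x = w x.
    rewrite coord_meanE; last by case: bw.
    under eq_Rintegral do rewrite ji wi.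
    rewrite Rintegral_cst// [X in fine X](segment_measureT (ltW (ab j)))/=.
    by rewrite mulrCA mulVf ?mulr1// gt_eqF// subr_gt0.
  under eq_Rintegral do rewrite /= wj subrr mulr0.
  by rewrite Rintegral_cst// mul0r.
apply: IH.
- by apply: bounded_borelB => //; exact: bm.
- by move: ijs; rewrite inE eq_sym (negbTE ji).
- move=> x t /=; rewrite wi; congr (_ - _).
  have [mw _] := bw; rewrite !coord_meanE//; congr (_ * _).
  apply: eq_Rintegral => u _; rewrite -[RHS](wi _ t); congr (w _).
  apply/rowP => k; rewrite !mxE.
  by case: (eqVneq k j) => [->|//]; rewrite (negbTE ji).
Qed.

End coordinate_means.

(** * Quantitative estimates *)

Section calculus.
Context {R : realType}.

(** The mean value theorem in a form symmetric in the two points. *)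
Lemma mvt_ball (f f' : R -> R) (x y : R) : (forall z : R, is_derive z (1:R) f (f' z)) ->
  exists2 c, `|c - x| <= `|y - x| & f y - f x = f' c * (y - x).
Proof.
move=> df; have cf := continuous_is_derive df.
wlog xy : x y / x <= y => [H|].
  have [xy|/ltW yx] := leP x y; first exact: H.
  have [c cyx E] := @MVT_segment _ f f' y x yx (fun z _ => df z) (continuous_subspaceT cf).
  exists c; last by rewrite -opprB E -mulrN opprB.
  move: cyx; rewrite in_itv/= => /andP[yc cx].
  by rewrite !ler0_norm ?subr_le0// lerN2 lerB.
have [c cyx E] := @MVT_segment _ f f' x y xy (fun z _ => df z) (continuous_subspaceT cf).
exists c; last by rewrite E.
move: cyx; rewrite in_itv/= => /andP[yc cx].
by rewrite !ger0_norm ?subr_ge0// lerB.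
Qed.

Lemma lipschitz_is_derive (f f' : R -> R) (C x y : R) :
  (forall z : R, is_derive z (1:R) f (f' z)) ->
  (forall z, `|f' z| <= C) -> `|f y - f x| <= C * `|y - x|.
Proof.
move=> df f'C; have [c _ ->] := mvt_ball x y df.
by rewrite normrM ler_wpM2r.
Qed.

Lemma taylor_is_derive (f f' f'' : R -> R) (C x h : R) :
  (forall z : R, is_derive z (1:R) f (f' z)) -> (forall z : R, is_derive z (1:R) f' (f'' z)) ->
  (forall z, `|f'' z| <= C) -> `|f (x + h) - f x - h * f' x| <= C * h ^+ 2.
Proof.
move=> df df' f''C; have [c cx E] := mvt_ball x (x + h) df.
move: cx E; rewrite (addrC x h) addrK => cx ->.
rewrite mulrC -mulrBr normrM -real_normK ?num_real// expr2 mulrCA ler_wpM2l//.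
apply: (le_trans (lipschitz_is_derive _ _ df' f''C)).
by rewrite ler_wpM2l// (le_trans _ (f''C 0)).
Qed.

(** Telescoping of a difference of products; the bounds are taken at least [1] so
    that they can all be kept in every term. *)
Lemma norm_prod_sub (I : Type) (s : seq I) (u v B : I -> R) :
  (forall i, 1 <= B i) -> (forall i, `|u i| <= B i) -> (forall i, `|v i| <= B i) ->
  `|\prod_(i <- s) u i - \prod_(i <- s) v i| <=
  (\sum_(i <- s) `|u i - v i|) * \prod_(i <- s) B i.
Proof.
move=> B1 uB vB; have B0 i : 0 <= B i by rewrite (le_trans ler01).
elim: s => [|i s IH].
  by rewrite !big_nil subrr normr0 mul0r.
rewrite !big_cons; set U := \prod_(j <- s) u j; set V := \prod_(j <- s) v j.
rewrite (_ : _ - _ = (u i - v i) * U + v i * (U - V)); last by ring.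
have UB : `|U| <= \prod_(j <- s) B j.
  by rewrite normr_prod; apply: ler_prod => j _; rewrite normr_ge0 uB.
have P0 : 0 <= \prod_(j <- s) B j by apply: prodr_ge0.
apply: (le_trans (ler_normD _ _)); rewrite !normrM mulrDl lerD//.
  by rewrite ler_wpM2l// (le_trans UB)// ler_peMl.
by rewrite mulrCA ler_pM.
Qed.

End calculus.

Section products.
Context {R : realType} d (T : measurableType d).

Lemma bounded_borel_cst (c : R) : bounded_borel (fun _ : T => c).
Proof. by split => //; exists `|c|. Qed.

Lemma bounded_borel_prod (I : Type) (s : seq I) (P : pred I) (u : I -> T -> R) :
  (forall i, bounded_borel (u i)) ->
  bounded_borel (fun x => \prod_(i <- s | P i) u i x).
Proof.
move=> bu; elim: s => [|i s IH].
  by under eq_fun do rewrite big_nil; exact: bounded_borel_cst.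
under eq_fun do rewrite big_cons.
by case: (P i) => //; exact: bounded_borelM.
Qed.

Lemma Rintegral_le (m : {finite_measure set T -> \bar R}) (f : T -> R) (M : R) :
  measurable_fun setT f -> (forall x, `|f x| <= M) ->
  `|\int[m]_x f x| <= M * fine (m setT).
Proof.
move=> mf fM; have bf : bounded_borel f by split => //; exists M.
apply: (le_trans (le_normr_Rintegral _ (bounded_borel_integrable m bf)))=> //.
rewrite -Rintegral_cst//; apply: le_Rintegral => //.
- apply: (bounded_borel_integrable m); split; first exact: measurableT_comp.
  by exists M => x; rewrite normr_id.
- exact: (bounded_borel_integrable m (bounded_borel_cst _)).
Qed.

End products.

Lemma lipschitz_continuous {R : realType} {V : normedModType R} (f : V -> R) (D : R) :
  (forall x z, `|f x - f z| <= D * `|x - z|) -> continuous f.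
Proof.
move=> lip x; apply/cvgrPdist_le => /= e e0.
have D1 : 0 < `|D| + 1 by rewrite ltr_wpDl.
have De : 0 < e / (`|D| + 1) by rewrite divr_gt0.
have xz : \forall z \near x, `|x - z| <= e / (`|D| + 1).
  have /cvgrPdist_le/(_ _ De) : id z @[z --> x] --> x by exact: cvg_id.
  exact.
near=> z; apply: (le_trans (lip _ _)).
rewrite (@le_trans _ _ ((`|D| + 1) * `|x - z|))//.
  by rewrite ler_wpM2r// (le_trans (ler_norm _))// lerDl.
by rewrite mulrC -ler_pdivlMr//; near: z.
Unshelve. all: by end_near. Qed.

Lemma coord_le_norm {R : realType} n (x : 'rV[R]_n) j : `|x ord0 j| <= `|x|.
Proof.
rewrite [leRHS]mx_normrE.
exact: (le_bigmax _ (fun ij : 'I_1 * 'I_n => `|x ij.1 ij.2|) (ord0, j)).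
Qed.

(** * Integrals of product kernels *)

Section kernel_integrals.
Context {R : realType} {d : nat}.
Variables (a b : 'rV[R]_d) (g : 'rV[R]_d -> R).
Local Notation mu := (box_measure a b).
Hypothesis bg : bounded_borel g.
Variable K : 'I_d -> nat -> R -> R -> R.
Variable C : 'I_d -> nat -> R.
Hypothesis dK : forall i m (x t : R), is_derive x (1:R) (K i m ^~ t) (K i m.+1 x t).
Hypothesis mK : forall i m x, measurable_fun setT (K i m x).
Hypothesis KC : forall i m x t, `|K i m x t| <= C i m.

Definition kernel_integral (al : 'I_d -> nat) (x : 'rV[R]_d) : R :=
  \int[mu]_y (g y * \prod_(i < d) K i (al i) (x ord0 i) (y ord0 i)).

Let bK i m x : bounded_borel (fun y : 'rV[R]_d => K i m x (y ord0 i)).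
Proof.
split; last by exists (C i m) => y; exact: KC.
exact: (measurableT_comp (mK i m x) (measurable_rV_coord i)).
Qed.

Let C0 i m : 0 <= C i m. Proof. exact: le_trans (KC i m 0 0). Qed.

(** Differentiation under the integral is immediate from Taylor's formula, because
    the second derivatives of the kernels are bounded and the box has finite
    measure. *)
Lemma kernel_integral_derive al i x :
  is_derive x (delta_mx ord0 i) (kernel_integral al)
    (kernel_integral (fun j => (al j + (j == i))%N) x).
Proof.
have [mg [M gM]] := bg.
have M0 : 0 <= M := le_trans (normr_ge0 _) (gM 0).
(* The coefficient of [h^2] in the remainder of the integrand: two extra
   derivatives in the coordinate [i], none in the others. *)
pose B := M * \prod_(j < d | j != i) C j (al j) * C i (al i).+2.
apply: (@is_derive_quadratic _ _ _ _ _ _ (B * fine (mu setT))) => h _.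
pose P (y : 'rV[R]_d) := \prod_(j < d | j != i) K j (al j) (x ord0 j) (y ord0 j).
have bP : bounded_borel P by exact: bounded_borel_prod.
have E1 : kernel_integral al (h *: delta_mx ord0 i + x) =
    \int[mu]_y (g y * (P y * K i (al i) (x ord0 i + h) (y ord0 i))).
  apply: eq_Rintegral => y _; congr (g y * _).
  rewrite (bigD1 i)//= mulrC; congr (_ * _).
    apply: eq_bigr => j ji; rewrite !mxE eqxx/=.
    by rewrite (negbTE ji) mulr0 add0r.
  by rewrite !mxE !eqxx/= mulr1 addrC.
have E2 : kernel_integral al x =
    \int[mu]_y (g y * (P y * K i (al i) (x ord0 i) (y ord0 i))).
  apply: eq_Rintegral => y _; congr (g y * _).
  by rewrite (bigD1 i)//= mulrC.
have E3 : kernel_integral (fun j => (al j + (j == i))%N) x =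
    \int[mu]_y (g y * (P y * K i (al i).+1 (x ord0 i) (y ord0 i))).
  apply: eq_Rintegral => y _; congr (g y * _).
  rewrite (bigD1 i)//= mulrC eqxx addn1; congr (_ * _).
  by apply: eq_bigr => j /negbTE ->; rewrite addn0.
have bF m u : bounded_borel (fun y => g y * (P y * K i m u (y ord0 i))).
  by do 2 apply: bounded_borelM => //.
have iF m u := bounded_borel_integrable mu (bF m u).
rewrite E1 E2 E3 -RintegralZl// -!RintegralB//; first last.
- exact: (bounded_borel_integrable mu (bounded_borelM (bounded_borel_cst _ h) (bF _ _))).
- exact: (bounded_borel_integrable mu (bounded_borelB (bF _ _) (bF _ _))).
rewrite mulrAC; apply: Rintegral_le => [|y].
  apply: measurable_funB; last by apply: measurable_funM => //; case: (bF (al i).+1 (x ord0 i)).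
  by apply: measurable_funB; [case: (bF (al i) (x ord0 i + h))|case: (bF (al i) (x ord0 i))].
rewrite (_ : _ - _ = g y * P y * (K i (al i) (x ord0 i + h) (y ord0 i) -
   K i (al i) (x ord0 i) (y ord0 i) - h * K i (al i).+1 (x ord0 i) (y ord0 i))); last by ring.
rewrite !normrM -[leRHS]mulrA; apply: ler_pM => //.
  apply: ler_pM => //; rewrite /P normr_prod; apply: ler_prod => j _.
  by rewrite normr_ge0 KC.
apply: (taylor_is_derive _ _ (dK i (al i) ^~ (y ord0 i)) (dK i (al i).+1 ^~ (y ord0 i))) => z.
exact: KC.
Qed.

Lemma kernel_integral_continuous al : continuous (kernel_integral al).
Proof.
have [mg [M gM]] := bg.
have M0 : 0 <= M := le_trans (normr_ge0 _) (gM 0).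
pose B j := 1 + C j (al j).
have B1 j : 1 <= B j by rewrite lerDl.
have KB j x t : `|K j (al j) x t| <= B j by rewrite (le_trans (KC _ _ _ _))// lerDr.
pose L := (\sum_(j < d) C j (al j).+1) * \prod_(j < d) B j.
have L0 : 0 <= L.
  by apply: mulr_ge0; [exact: sumr_ge0|apply: prodr_ge0 => j _; rewrite (le_trans ler01)].
have V0 : 0 <= fine (mu setT) by rewrite fine_ge0.
have lip x z : `|kernel_integral al x - kernel_integral al z| <=
    M * L * fine (mu setT) * `|x - z|.
  have bF u : bounded_borel (fun y => g y * \prod_(i < d) K i (al i) (u i) (y ord0 i)).
    by apply: bounded_borelM => //; exact: bounded_borel_prod.
  have iF u := bounded_borel_integrable mu (bF u).
  rewrite /kernel_integral.
  rewrite -(RintegralB measurableT (iF (fun i => x ord0 i)) (iF (fun i => z ord0 i))).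
  rewrite mulrAC; apply: Rintegral_le => [|y].
    apply: measurable_funB.
      by case: (bF (fun i => x ord0 i)).
    by case: (bF (fun i => z ord0 i)).
  rewrite -mulrBr normrM -mulrA; apply: ler_pM => //.
  apply: (le_trans (norm_prod_sub _ B1 (fun j => KB j (x ord0 j) (y ord0 j))
    (fun j => KB j (z ord0 j) (y ord0 j)))).
  rewrite /L mulrAC ler_wpM2r//.
    by apply: prodr_ge0 => j _; rewrite (le_trans ler01).
  rewrite mulr_suml; apply: ler_sum => j _.
  apply: (le_trans (lipschitz_is_derive (C := C j (al j).+1) _ _
    (dK j (al j) ^~ (y ord0 j)) _)) => [u|]; first exact: KC.
  rewrite ler_wpM2l//.
  by have := coord_le_norm (x - z) j; rewrite !mxE.
exact: (lipschitz_continuous lip).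
Qed.

(** The order of differentiation disappears: only the number of derivatives in each
    coordinate matters. *)
Lemma kernel_integral_partials (s : seq 'I_d) :
  partials s (kernel_integral (fun=> 0%N)) = kernel_integral (fun j => count_mem j s).
Proof.
elim: s => [//|i s IH]; rewrite /= IH; apply/funext => x.
rewrite (derive_val (is_derive := kernel_integral_derive _ _ _)).
congr kernel_integral; apply/funext => j /=.
by rewrite addnC eq_sym.
Qed.

Lemma kernel_integral_smooth : smooth (kernel_integral (fun=> 0%N)).
Proof.
move=> s; rewrite kernel_integral_partials; split.
  exact: kernel_integral_continuous.
by move=> i x; have [] := kernel_integral_derive (fun j => count_mem j s) i x.
Qed.

Lemma kernel_integral_test_function (r : R) :
  (forall i x t, a ord0 i <= t <= b ord0 i -> r < `|x| -> K i 0%N x t = 0) ->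
  test_function (kernel_integral (fun=> 0%N)).
Proof.
move=> K0; split; first exact: kernel_integral_smooth.
pose Q := [set x : 'rV[R]_d | forall i, `[- r, r]%classic (x ord0 i)].
have cQ : compact Q.
  by apply: (@rV_compact R d (fun=> `[- r, r]%classic)) => i; exact: segment_compact.
have clQ : closed Q by apply: compact_closed => //; exact: norm_hausdorff.
apply: (subclosed_compact _ cQ); first exact: closed_closure.
rewrite [X in _ `<=` X](closure_id _).1//; apply: closure_subset => x /= /eqP Zx i.
rewrite /= in_itv/= -ler_norml leNgt; apply/negP => rx; apply: Zx.
rewrite /kernel_integral /Rintegral integral_mrestr; last first.
  apply/measurable_EFinP; apply: measurable_funM; first by case: bg.
  by apply: measurable_prod => j _; case: (bK j 0%N (x ord0 j)).
rewrite integral0_eq// => y yab; rewrite (bigD1 i)//= (K0 _ _ _ (yab i))//.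
by rewrite mul0r mulr0.
Qed.

End kernel_integrals.

(** * Kernels built from a smooth step *)

Section ftc_everywhere.
Context {R : realType}.

Lemma integral_is_derive (f f' : R -> R) (p q : R) : p <= q ->
  (forall z : R, is_derive z (1:R) f (f' z)) -> continuous f' ->
  (\int[lebesgue_measure]_(t in `[p, q]) (f' t)%:E = (f q - f p)%:E)%E.
Proof.
move=> pq df cf'; have cf := continuous_is_derive df.
move: pq; rewrite le_eqVlt => /predU1P[->|pq].
  by rewrite set_itv1 integral_set1 subrr.
rewrite (continuous_FTC2 (F := f) pq)//.
- exact: continuous_subspaceT.
- split; first by move=> x _; case: (df x).
  + by apply: cvg_at_right_filter; exact: cf.
  + by apply: cvg_at_left_filter; exact: cf.
- by move=> x _; rewrite derive1E; case: (df x).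
Qed.

Lemma is_derive_shift_arg (f f' : R -> R) (t x : R) :
  (forall z : R, is_derive z (1:R) f (f' z)) ->
  is_derive x (1:R) (fun x => f (x - t)) (f' (x - t)).
Proof.
move=> df.
have dg : is_derive x (1:R) (fun x : R => x - t) 1.
  by apply: is_derive_eq; rewrite subr0.
by have := @is_derive1_comp R f (fun x => x - t) x _ _ (df (x - t)) dg; rewrite mulr1.
Qed.

Lemma is_derive_reflect_arg (f f' : R -> R) (t x : R) :
  (forall z : R, is_derive z (1:R) f (f' z)) ->
  is_derive t (1:R) (fun t => - f (x - t)) (f' (x - t)).
Proof.
move=> df.
have dg : is_derive t (1:R) (fun t : R => x - t) (-1).
  by have := is_deriveB (is_derive_cst x t (1:R)) (is_derive_id t (1:R)); rewrite sub0r.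
have dh := @is_derive1_comp R f (fun t => x - t) t _ _ (df (x - t)) dg.
have := is_deriveN dh.
by rewrite mulrN1 opprK.
Qed.

End ftc_everywhere.

Section box_tensor.
Context {R : realType}.
Local Open Scope ereal_scope.

Lemma integral_tensor_rectangle n (B : 'I_n -> set R) (u : 'I_n -> R -> \bar R) :
  (forall i, measurable (B i)) ->
  (forall i, measurable_fun setT (u i)) -> (forall i t, 0 <= u i t) ->
  \int[lebesgue_rV]_(x in rectangle B) \big[*%E/1]_(i < n) u i (x ord0 i) =
  \big[*%E/1]_(i < n) \int[lebesgue_measure]_(t in B i) u i t.
Proof.
move=> mB mu u0; rewrite integral_mkcond.
transitivity (\int[lebesgue_rV]_x \big[*%E/1]_(i < n) (u i \_ (B i)) (x ord0 i)).
  apply: eq_integral => x _; rewrite patchE; case: ifPn => [|].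
    by rewrite inE => xB; apply: eq_bigr => i _; rewrite patchE mem_set.
  move=> /negP xB; have [i xi] : exists i, ~ B i (x ord0 i).
    by apply: contrapT => H; apply: xB; rewrite inE => i; apply: contrapT => xi; apply: H; exists i.
  by rewrite (bigD1 i)//= patchE memNset ?mul0e.
rewrite (integral_tensor (u := fun i => u i \_ (B i))).
- by apply: eq_bigr => i _; rewrite [RHS]integral_mkcond.
- by move=> i; apply/(measurable_restrictT _ _).1 => //; exact: measurable_funTS.
- by move=> i t; rewrite patchE; case: ifPn.
Qed.

Lemma integral_tensor_box n (a b : 'rV[R]_n) (u : 'I_n -> R -> \bar R) :
  (forall i, measurable_fun setT (u i)) -> (forall i t, 0 <= u i t) ->
  \int[box_measure a b]_x \big[*%E/1]_(i < n) u i (x ord0 i) =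
  \big[*%E/1]_(i < n) \int[lebesgue_measure]_(t in `[a ord0 i, b ord0 i]) u i t.
Proof.
move=> mu u0.
rewrite ge0_integral_mrestr; first last.
- by move=> x; elim/big_ind : _ => //; exact: mule_ge0.
- apply: measurable_fun_prode => i.
  exact: (measurableT_comp (mu i) (measurable_rV_coord i)).
by rewrite box_rectangle integral_tensor_rectangle.
Qed.

End box_tensor.

Section step_kernel.
Context {R : realType} {d : nat}.
Variables (a b : 'rV[R]_d) (I : {set 'I_d}) (F : nat -> R -> R) (CF : nat -> R).
Hypothesis ab : forall i, a ord0 i < b ord0 i.
Hypothesis dF : forall m (x : R), is_derive x (1:R) (F m) (F m.+1 x).
Hypothesis FC : forall m x, `|F m x| <= CF m.
Hypothesis Fl : forall x : R, x <= -1 -> F 0%N x = 0.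
Hypothesis Fr : forall x : R, 0 <= x -> F 0%N x = 1.
Hypothesis F1_ge0 : forall x : R, 0 <= F 1%N x.

(** With [F] a smooth step with derivatives [F m], the kernel for [i] in [I] is, for
    [t] in [[a_i, b_i]], the convolution of the bump [F 1] with the function
    [s |-> (1/2) sgn(s - t)] cut off to [[a_i, b_i]]. For the other coordinates it
    is the bump itself. The index [m] counts derivatives in [x]. *)
Definition step_kernel (i : 'I_d) (m : nat) (x t : R) : R :=
  if i \in I then F m (x - t) - 2^-1 * (F m (x - a ord0 i) + F m (x - b ord0 i))
  else F m.+1 (x - t).

Let cF m : continuous (F m) := continuous_is_derive (dF m).

Lemma step_homo : {homo F 0%N : x y / x <= y}.
Proof.
move=> x y; rewrite le_eqVlt => /predU1P[->//|xy].
have [c _ E] := @MVT_segment _ _ _ x y (ltW xy)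
  (fun z _ => dF 0%N z) (continuous_subspaceT (cF (m:=0%N))).
by rewrite -subr_ge0 E mulr_ge0// subr_ge0 ltW.
Qed.

Lemma step_ge0 x : 0 <= F 0%N x.
Proof.
have [x1|x1] := leP x (-1); first by rewrite Fl.
by rewrite -(Fl (lexx _)); apply: step_homo; exact: ltW.
Qed.

Lemma step_le1 x : F 0%N x <= 1.
Proof.
have [x1|x1] := leP 0 x; first by rewrite Fr.
by rewrite -(Fr (lexx _)); apply: step_homo; exact: ltW.
Qed.

Lemma step_derive_eq0 x : x < -1 \/ 0 < x -> F 1%N x = 0.
Proof.
move=> x0; have [_ <-] := dF 0%N x.
have [c Fc] : exists c, \forall z \near x, cst c z = F 0%N z.
  case: x0 => x0.
    exists 0; near=> z; rewrite Fl//; apply: ltW; near: z; exact: lt_nbhsl.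
  exists 1; near=> z; rewrite Fr//; apply: ltW; near: z; exact: lt_nbhsr.
by rewrite -(near_eq_derive (1:R) Fc) derive_cst.
Unshelve. all: by end_near. Qed.

Lemma step_kernel_derive i m (x t : R) :
  is_derive x (1:R) (step_kernel i m ^~ t) (step_kernel i m.+1 x t).
Proof.
rewrite /step_kernel; case: (i \in I); last exact: is_derive_shift_arg.
have d1 := is_derive_shift_arg t x (dF m).
have d2 := is_derive_shift_arg (a ord0 i) x (dF m).
have d3 := is_derive_shift_arg (b ord0 i) x (dF m).
have := is_deriveB d1 (is_deriveZ 2^-1 (is_deriveD d2 d3)).
done.
Qed.

Lemma measurable_step d' (T : measurableType d') m (h : T -> R) : measurable_fun setT h ->
  measurable_fun setT (fun t => F m (h t)).
Proof.
move=> mh; apply: (@measurableT_comp _ _ _ _ _ _ (F m)) => //.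
exact: continuous_measurable_fun.
Qed.

Lemma measurable_step_kernel i m x : measurable_fun setT (step_kernel i m x).
Proof.
have ms k : measurable_fun setT (fun t : R => F k (x - t)).
  by apply: measurable_step; apply: measurable_funB.
rewrite /step_kernel; case: (i \in I); last exact: ms.
by apply: measurable_funB.
Qed.

Lemma step_kernel_bound i m x t : `|step_kernel i m x t| <= 2 * CF m + CF m.+1.
Proof.
have C0 k : 0 <= CF k := le_trans (normr_ge0 _) (FC k 0).
rewrite /step_kernel; case: (i \in I); last first.
  by rewrite (le_trans (FC _ _))// lerDr mulr_ge0.
have := FC m (x - t); have := FC m (x - a ord0 i); have := FC m (x - b ord0 i).
have := C0 m; have := C0 m.+1; rewrite !ler_norml => ? ?.
move=> /andP[? ?] /andP[? ?] /andP[? ?]; apply/andP; split; lra.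
Qed.

(** As [t] lies in [[a_i, b_i]] and the step is monotone, [F 0 (x - t)] lies between
    the two values whose mean is subtracted, and these differ by at most [1]. *)
Lemma step_kernel_half i x t : i \in I -> a ord0 i <= t <= b ord0 i ->
  `|step_kernel i 0%N x t| <= 2^-1.
Proof.
move=> iI /andP[at_ tb]; rewrite /step_kernel iI.
have h1 : F 0%N (x - t) <= F 0%N (x - a ord0 i) by apply: step_homo; lra.
have h2 : F 0%N (x - b ord0 i) <= F 0%N (x - t) by apply: step_homo; lra.
have := step_ge0 (x - b ord0 i); have := step_le1 (x - a ord0 i).
by rewrite ler_norml => ? ?; apply/andP; split; lra.
Qed.

Lemma step_kernel_support i x t : a ord0 i <= t <= b ord0 i ->
  \sum_j (`|a ord0 j| + `|b ord0 j|) + 1 < `|x| -> step_kernel i 0%N x t = 0.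
Proof.
move=> /andP[at_ tb] xr.
have {xr}xr : `|a ord0 i| + `|b ord0 i| + 1 < `|x|.
  apply: le_lt_trans xr; rewrite lerD2r (bigD1 i)//= lerDl.
  by apply: sumr_ge0 => j _; rewrite addr_ge0.
have xab : x < a ord0 i - 1 \/ b ord0 i < x.
  move: xr; have := ler_norm (b ord0 i); have := ler_norm (- a ord0 i).
  have := normr_ge0 (a ord0 i); have := normr_ge0 (b ord0 i); rewrite normrN.
  by case: (lerP 0 x) => x0 ? ? ? ? xr;
    [rewrite (ger0_norm x0) in xr|rewrite (ltr0_norm x0) in xr]; [right|left]; lra.
rewrite /step_kernel; case: ifP => iI.
  case: xab => xab; first by rewrite !Fl; lra.
  by rewrite !Fr; lra.
by apply: step_derive_eq0; case: xab => xab; [left|right]; lra.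
Qed.

Lemma segment_step i (x : R) :
  (\int[lebesgue_measure]_(t in `[a ord0 i, b ord0 i]) (F 1%N (x - t))%:E <= 1)%E.
Proof.
have c1 : continuous (fun t : R => F 1%N (x - t)).
  move=> t; apply: (@continuous_comp _ _ _ (fun t : R => x - t) (F 1%N)).
    by apply: cvgB; [exact: cvg_cst|exact: cvg_id].
  exact: (continuous_is_derive (dF 1%N)).
have -> := integral_is_derive (ltW (ab i))
  (fun t : R => @is_derive_reflect_arg R _ _ t x (dF 0%N)) c1.
rewrite lee_fin opprK addrC lerBlDr.
by rewrite (le_trans (step_le1 _))// lerDl step_ge0.
Qed.

Lemma mollifier_mass (x : 'rV[R]_d) :
  (\int[box_measure a b]_y (\prod_(i < d) F 1%N (x ord0 i - y ord0 i))%:E <= 1)%E.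
Proof.
under eq_integral do rewrite -prodEFin.
have mu1 i : measurable_fun setT (fun t : R => (F 1%N (x ord0 i - t))%:E).
  apply/measurable_EFinP; apply: measurable_step.
  exact: measurable_funB.
have u0 i t : (0 <= (F 1%N (x ord0 i - t))%:E)%E by rewrite lee_fin.
rewrite (integral_tensor_box a b mu1 u0).
have : (0 <= \big[*%E/1]_(i < d) \int[lebesgue_measure]_(t in `[a ord0 i, b ord0 i])
    (F 1%N (x ord0 i - t))%:E <= 1)%E.
  elim/big_ind : _ => [|v w /andP[v0 v1] /andP[w0 w1]|i _].
  - by rewrite lee01 lexx.
  - by rewrite mule_ge0//= -[leRHS]mule1 lee_pmul.
  - by rewrite segment_step andbT integral_ge0// => t _; rewrite lee_fin.
by move=> /andP[].
Qed.

End step_kernel.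

(** * The mollified antiderivative *)

Lemma measurable_abse_EFin {R : realType} d (T : measurableType d) (f : T -> R) :
  measurable_fun setT f -> measurable_fun setT (fun x => `|(f x)%:E|%E).
Proof.
move=> mf; have mn : measurable_fun setT (fun x => `|f x|) by exact: measurableT_comp.
by have /measurable_EFinP := mn.
Qed.

Section mollifier.
Context {R : realType} {d : nat}.
Variables (a b : 'rV[R]_d) (I : {set 'I_d}) (F : nat -> R -> R) (CF : nat -> R).
Hypothesis ab : forall i, a ord0 i < b ord0 i.
Hypothesis dF : forall m (x : R), is_derive x (1:R) (F m) (F m.+1 x).
Hypothesis FC : forall m x, `|F m x| <= CF m.
Hypothesis Fl : forall x : R, x <= -1 -> F 0%N x = 0.
Hypothesis Fr : forall x : R, 0 <= x -> F 0%N x = 1.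
Hypothesis F1_ge0 : forall x : R, 0 <= F 1%N x.
Variable psi : 'rV[R]_d -> R.
Hypothesis bpsi : bounded_borel psi.
Local Notation mu := (box_measure a b).
Hypothesis psi_orth : forall i (w : 'rV[R]_d -> R), i \in I -> bounded_borel w ->
  (forall x t, w (update_rV i x t) = w x) -> \int[mu]_y (psi y * w y) = 0.

Local Notation K := (step_kernel a b I F).
Local Notation m1 := (box_measure (proj_rV (~: I) a) (proj_rV (~: I) b)).
Local Notation m2 := (box_measure (proj_rV I a) (proj_rV I b)).

Definition antiderivative : 'rV[R]_d -> R := kernel_integral a b psi K (fun=> 0%N).

Definition mollification (x : 'rV[R]_d) : R :=
  \int[mu]_y (psi y * \prod_(i < d) F 1%N (x ord0 i - y ord0 i)).

Let dK := step_kernel_derive a b I dF.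
Let mK := measurable_step_kernel a b I dF.
Let KC := step_kernel_bound a b I FC.

Lemma antiderivative_test_function : test_function antiderivative.
Proof.
apply: (@kernel_integral_test_function _ _ a b psi bpsi K
  (fun _ m => 2 * CF m + CF m.+1) dK mK KC
  (\sum_j (`|a ord0 j| + `|b ord0 j|) + 1)) => i x t.
exact: (step_kernel_support I dF Fl Fr).
Qed.

Lemma measurable_antiderivative : measurable_fun setT antiderivative.
Proof.
pose J (xy : 'rV[R]_d * 'rV[R]_d) :=
  psi xy.2 * \prod_(i < d) K i 0%N (xy.1 ord0 i) (xy.2 ord0 i).
have m1 i : measurable_fun setT (fun xy : 'rV[R]_d * 'rV[R]_d => xy.1 ord0 i).
  exact: (measurableT_comp (measurable_rV_coord i) measurable_fst).
have m2 i : measurable_fun setT (fun xy : 'rV[R]_d * 'rV[R]_d => xy.2 ord0 i).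
  exact: (measurableT_comp (measurable_rV_coord i) measurable_snd).
have bJ : bounded_borel J.
  apply: bounded_borelM; first exact: (bounded_borel_comp bpsi measurable_snd).
  apply: bounded_borel_prod => i; split; last by exists (2 * CF 0%N + CF 1%N) => xy; exact: KC.
  have ms m (h : 'rV[R]_d * 'rV[R]_d -> R) : measurable_fun setT h ->
    measurable_fun setT (fun xy => F m (h xy)) by exact: measurable_step.
  rewrite /step_kernel; case: (i \in I); last by apply: ms; exact: measurable_funB.
  apply: measurable_funB; first by apply: ms; exact: measurable_funB.
  apply: measurable_funM => //.
  by apply: measurable_funD; apply: ms; exact: measurable_funB.
have iJ := @bounded_borel_integrable_prod _ _ _ _ _ mu mu _ bJ.
have mG := measurable_fubini_F iJ.
rewrite (_ : antiderivative = fine \o fubini_F mu (EFin \o J))//.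
by apply: (@measurableT_comp _ _ _ _ _ _ fine).
Qed.

Let bF (x : 'rV[R]_d) i : bounded_borel (fun y : 'rV[R]_d => F 1%N (x ord0 i - y ord0 i)).
Proof.
split; last by exists (CF 1%N).
apply: (measurable_step dF); apply: measurable_funB => //.
exact: measurable_rV_coord.
Qed.

(** Each differentiated kernel with [i] in [I] differs from the bump by a quantity
    that does not depend on [y_i]. These quantities are removed one coordinate at a
    time, each being orthogonal to [psi]. *)
Lemma partials_antiderivative : partials (enum I) antiderivative = mollification.
Proof.
rewrite (kernel_integral_partials a b bpsi dK mK KC); apply/funext => x.
pose k (s : seq 'I_d) i (t : R) := if i \in s then
  F 1%N (x ord0 i - t) - 2^-1 * (F 1%N (x ord0 i - a ord0 i) + F 1%N (x ord0 i - b ord0 i))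
  else F 1%N (x ord0 i - t).
transitivity (\int[mu]_y (psi y * \prod_(i < d) k (enum I) i (y ord0 i))).
  apply: eq_Rintegral => y _; congr (_ * _); apply: eq_bigr => i _.
  rewrite count_uniq_mem ?enum_uniq// /k /step_kernel mem_enum.
  by case: (i \in I).
have bk s i : bounded_borel (fun y : 'rV[R]_d => k s i (y ord0 i)).
  rewrite /k; case: (i \in s) => //; apply: (bounded_borelB (bF x i)).
  exact: bounded_borel_cst.
have : {subset enum I <= I} by move=> i; rewrite mem_enum.
elim: (enum I) => [|i s IH] sI.
  by apply: eq_Rintegral => y _; congr (_ * _); apply: eq_bigr => j _.
rewrite -IH; last by move=> j js; apply: sI; rewrite inE js orbT.
have [is_|is_] := boolP (i \in s).
  apply: eq_Rintegral => y _; congr (_ * _); apply: eq_bigr => j _.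
  by rewrite /k inE; case: eqP => // ->; rewrite is_.
(* The part of the differentiated kernel that does not depend on [y_i]. *)
pose c := 2^-1 * (F 1%N (x ord0 i - a ord0 i) + F 1%N (x ord0 i - b ord0 i)).
pose w (y : 'rV[R]_d) := c * \prod_(j < d | j != i) k s j (y ord0 j).
have bw : bounded_borel w.
  apply: bounded_borelM; first exact: bounded_borel_cst.
  exact: bounded_borel_prod.
have -> : \int[mu]_y (psi y * \prod_(j < d) k s j (y ord0 j)) =
    \int[mu]_y (psi y * \prod_(j < d) k s j (y ord0 j)) - \int[mu]_y (psi y * w y).
  rewrite (psi_orth (i := i) _ bw) ?subr0//; first by apply: sI; rewrite mem_head.
  move=> y t; rewrite /w; congr (_ * _); apply: eq_bigr => j ji.
  by rewrite mxE (negbTE ji).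
rewrite -RintegralB//; last 2 first.
- apply: (bounded_borel_integrable mu); apply: bounded_borelM => //.
  exact: bounded_borel_prod.
- exact: (bounded_borel_integrable mu (bounded_borelM bpsi bw)).
apply: eq_Rintegral => y _; rewrite -mulrBr; congr (_ * _).
rewrite (bigD1 i)//= [in RHS](bigD1 i)//= /w -mulrBl; congr (_ * _).
  by rewrite /k mem_head (negbTE is_).
apply: eq_bigr => j ji; by rewrite /k inE (negbTE ji).
Qed.

Lemma mollification_bound M : (forall x, `|psi x| <= M) -> forall x, `|mollification x| <= M.
Proof.
move=> psiM x; have M0 : 0 <= M := le_trans (normr_ge0 _) (psiM 0).
have bP : bounded_borel (fun y : 'rV[R]_d => \prod_(i < d) F 1%N (x ord0 i - y ord0 i)).
  exact: bounded_borel_prod.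
have P0 y : 0 <= \prod_(i < d) F 1%N (x ord0 i - y ord0 i) by exact: prodr_ge0.
have iP := bounded_borel_integrable mu (bounded_borelM bpsi bP).
rewrite /mollification -lee_fin EFin_normr_Rintegral//.
apply: (le_trans (le_abse_integral _ _ _)) => //.
  by apply/measurable_EFinP; case: (bounded_borelM bpsi bP).
apply: (@le_trans _ _ (\int[mu]_y (M%:E * (\prod_(i < d) F 1%N (x ord0 i - y ord0 i))%:E))%E).
  apply: ge0_le_integral => //.
  - by apply: measurable_abse_EFin; case: (bounded_borelM bpsi bP).
  - by apply: measurable_funeM; apply/measurable_EFinP; case: bP.
  - by move=> y _; rewrite /= lee_fin normrM [X in _ * X]ger0_norm// ler_wpM2r.
rewrite ge0_integralZl//; last 2 first.
- by apply/measurable_EFinP; case: bP.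
- by move=> y _; rewrite lee_fin.
by rewrite -[leRHS]mule1 lee_wpmul2l// ?lee_fin// (mollifier_mass ab dF Fl Fr F1_ge0).
Qed.

(** Splitting the coordinates of [y], the kernels with [i] in [I] contribute the
    factors [1/2], the inner integral of [|psi|] is at most [L] for almost every
    value of the outer variables, and the remaining bumps have total mass at most
    [1]. The outer integral turns the almost everywhere bound into a bound at
    every point [x]. *)
Lemma antiderivative_bound (L : R) : 0 <= L ->
  (\forall u \ae m1, (\int[m2]_t `|psi (merge_rV u t)|%:E <= L%:E)%E) ->
  forall x, `|antiderivative x| <= 2 ^- #|I| * L.
Proof.
move=> L0 psiL x.
pose P (y : 'rV[R]_d) := \prod_(i < d) K i 0%N (x ord0 i) (y ord0 i).
have bP : bounded_borel P.
  apply: bounded_borel_prod => i; split; last by exists (2 * CF 0%N + CF 1%N) => y; exact: KC.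
  exact: (measurableT_comp (mK i 0%N (x ord0 i)) (measurable_rV_coord i)).
have mP : measurable_fun setT (fun y => psi y * P y) by case: (bounded_borelM bpsi bP).
have iP := bounded_borel_integrable mu (bounded_borelM bpsi bP).
pose N := \prod_(i in I) (2^-1 : R).
pose Q (y : 'rV[R]_d) := \prod_(i in ~: I) F 1%N (x ord0 i - y ord0 i).
have Q0 y : 0 <= Q y by exact: prodr_ge0.
have bQ : bounded_borel Q by exact: bounded_borel_prod.
have [mpsi _] := bpsi.
have NE : N = 2 ^- #|I| by rewrite /N prodr_const exprVn.
have N0 : 0 <= N by exact: prodr_ge0.
have mG : measurable_fun setT (fun y => (N * Q y * `|psi y|)%:E).
  apply/measurable_EFinP; apply: measurable_funM; last exact: measurableT_comp.
  by apply: measurable_funM => //; case: bQ.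
have G0 y : (0 <= (N * Q y * `|psi y|)%:E)%E by rewrite lee_fin !mulr_ge0.
rewrite /antiderivative /kernel_integral -lee_fin EFin_normr_Rintegral//.
apply: (le_trans (le_abse_integral _ _ _)) => //; first exact/measurable_EFinP.
apply: (@le_trans _ _ (\int[mu]_y (N * Q y * `|psi y|)%:E)%E).
  rewrite ge0_integral_mrestr//; last exact: measurable_abse_EFin.
  rewrite ge0_integral_mrestr//.
  apply: ge0_le_integral => //.
  - exact: measurable_box.
  - apply: measurable_funTS; exact: measurable_abse_EFin.
  - exact: measurable_funTS.
  - move=> y yab; rewrite /= lee_fin normrM mulrC ler_wpM2r//.
    rewrite normr_prod (bigID (mem I))/= /N /Q; apply: ler_pM.
    + exact: prodr_ge0.
    + exact: prodr_ge0.
    + apply: ler_prod => i iI; rewrite normr_ge0/=.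
      exact: (step_kernel_half dF Fl Fr F1_ge0).
    + rewrite le_eqVlt; apply/orP; left; apply/eqP.
      rewrite [RHS](eq_bigl (fun i => i \notin I)) => [|i]; last by rewrite finset.in_setC.
      apply: eq_bigr => i iI; rewrite /step_kernel (negbTE iI) ger0_norm//.
pose Qu (u : 'rV[R]_#|~: I|) := \prod_(k < #|~: I|) F 1%N (proj_rV (~: I) x ord0 k - u ord0 k).
have Qu0 u : 0 <= Qu u by exact: prodr_ge0.
have QE u t : Q (merge_rV u t) = Qu u.
  rewrite /Q /Qu big_enum_val; apply: eq_bigr => k _.
  by rewrite merge_rV_notin mxE.
have mmerge u : measurable_fun setT (fun t => merge_rV (R:=R) (I:=I) u t).
  exact: (measurableT_comp (@measurable_merge R d I) (pair1_measurable u)).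
have mabs (u : 'rV[R]_#|~: I|) : measurable_fun setT (fun t => `|psi (merge_rV u t)|%:E).
  exact: (measurable_abse_EFin (measurableT_comp mpsi (mmerge u))).
have mQu : measurable_fun setT (fun u => (Qu u)%:E).
  apply/measurable_EFinP; apply: measurable_prod => k _.
  by apply: (measurable_step dF); apply: measurable_funB => //; exact: measurable_rV_coord.
rewrite (ge0_integral_transfer (mu := (m1 \x m2)%E) (@measurable_merge R d I)
  (@box_merge R d a b I))//.
have mGm := measurableT_comp mG (@measurable_merge R d I).
rewrite fubini_tonelli1//.
have GE u : fubini_F m2 (fun ut => (N * Q (merge_pair ut) * `|psi (merge_pair ut)|)%:E) u =
    ((N * Qu u)%:E * \int[m2]_t `|psi (merge_rV u t)|%:E)%E.
  rewrite /fubini_F /= -ge0_integralZl//; [|exact: mabs|by rewrite lee_fin mulr_ge0].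
  by apply: eq_integral => t _; rewrite /merge_pair /= QE EFinM.
apply: (@le_trans _ _ (\int[m1]_u ((N * L)%:E * (Qu u)%:E))%E).
  apply: ae_ge0_le_integral => //.
  - by move=> u _; apply: integral_ge0.
  - exact: measurable_fun_fubini_tonelli_F.
  - by move=> u _; rewrite lee_fin !mulr_ge0.
  - exact: measurable_funeM.
  - move: psiL; apply: filterS => u uL _.
    rewrite GE (_ : ((N * L)%:E * _)%E = ((N * Qu u)%:E * L%:E)%E); last first.
      by rewrite -!EFinM mulrAC.
    rewrite lee_wpmul2l//.
    by rewrite lee_fin mulr_ge0.
rewrite ge0_integralZl//; last 2 first.
- by move=> u _; rewrite lee_fin.
- by rewrite lee_fin mulr_ge0.
rewrite -NE -[leRHS]mule1 lee_wpmul2l// ?lee_fin ?mulr_ge0//.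
apply: (mollifier_mass _ dF Fl Fr F1_ge0) => k.
by rewrite !mxE.
Qed.

End mollifier.

(** * Weak convergence against integrable functions *)

Section weak_convergence.
Context {R : realType} d (T : measurableType d) (m : {finite_measure set T -> \bar R}).
Variables (G : set (set T)) (u_ : (T -> R)^nat) (u : T -> R) (M : R).
Hypothesis mG : measurable = <<s G >>.
Hypothesis setIG : setI_closed G.
Hypothesis GT : G setT.
Hypothesis mu_ : forall n, measurable_fun setT (u_ n).
Hypothesis mu : measurable_fun setT u.
Hypothesis u_M : forall n x, `|u_ n x| <= M.
Hypothesis uM : forall x, `|u x| <= M.

Let weak (h : T -> R) :=
  \int[m]_x (h x * u_ n x) @[n --> \oo] --> \int[m]_x (h x * u x).

Let M0 : 0 <= M. Proof. exact: le_trans (normr_ge0 _) (uM point). Qed.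

Let iZ c (h : T -> R) : m.-integrable setT (EFin \o h) ->
  m.-integrable setT (EFin \o (fun x => c * h x)).
Proof. by move=> ih; exact: (integrableZl measurableT c ih). Qed.

Let iB (h k : T -> R) : m.-integrable setT (EFin \o h) ->
  m.-integrable setT (EFin \o k) -> m.-integrable setT (EFin \o (fun x => h x - k x)).
Proof. by move=> ih ik; exact: (integrableB measurableT ih ik). Qed.

Let iN (h : T -> R) : m.-integrable setT (EFin \o h) ->
  m.-integrable setT (EFin \o (fun x => `|h x|)).
Proof. by move=> ih; exact: (integrable_norm ih). Qed.

Let integrableM (h v : T -> R) : m.-integrable setT (EFin \o h) ->
  measurable_fun setT v -> (forall x, `|v x| <= M) ->
  m.-integrable setT (EFin \o (fun x => h x * v x)).
Proof. exact: integrable_mul_bounded. Qed.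

Let weakD h k : m.-integrable setT (EFin \o h) -> m.-integrable setT (EFin \o k) ->
  weak h -> weak k -> weak (h \+ k).
Proof.
move=> ih ik wh wk.
have E (v : T -> R) : measurable_fun setT v -> (forall x, `|v x| <= M) ->
    \int[m]_x ((h \+ k) x * v x) = \int[m]_x (h x * v x) + \int[m]_x (k x * v x).
  move=> mv vM; rewrite -RintegralD//; [|exact: integrableM|exact: integrableM].
  by apply: eq_Rintegral => x _; rewrite /= mulrDl.
rewrite /weak E//; under eq_fun do rewrite E//.
exact: cvgD.
Qed.

Let weakZ c h : m.-integrable setT (EFin \o h) -> weak h -> weak (fun x => c * h x).
Proof.
move=> ih wh.
have E (v : T -> R) : measurable_fun setT v -> (forall x, `|v x| <= M) ->
    \int[m]_x (c * h x * v x) = c * \int[m]_x (h x * v x).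
  move=> mv vM; rewrite -RintegralZl//; last exact: integrableM.
  by apply: eq_Rintegral => x _; rewrite mulrA.
rewrite /weak E//; under eq_fun do rewrite E//.
by apply: cvgM => //; exact: cvg_cst.
Qed.

Let approx h (k_ : (T -> R)^nat) : m.-integrable setT (EFin \o h) ->
  (forall n, m.-integrable setT (EFin \o k_ n)) -> (forall n, weak (k_ n)) ->
  \int[m]_x `|h x - k_ n x| @[n --> \oo] --> 0 -> weak h.
Proof.
move=> ih ik wk hk; apply/cvgrPdist_le => /= e e0.
have e3 : 0 < e / 3 by rewrite divr_gt0.
(* [M + 1] rather than [M], which may be zero. *)
have eM : 0 < e / 3 / (M + 1) by rewrite divr_gt0// ltr_wpDl.
have /cvgrPdist_le /(_ _ eM) [N _ /(_ N (leqnn _))] := hk.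
rewrite sub0r normrN ger0_norm; last by apply: Rintegral_ge0.
move=> hN.
have dist (v : T -> R) : measurable_fun setT v -> (forall x, `|v x| <= M) ->
    `|\int[m]_x (h x * v x) - \int[m]_x (k_ N x * v x)| <= e / 3.
  move=> mv vM; rewrite -RintegralB//; [|exact: integrableM|exact: integrableM].
  have ihk : m.-integrable setT (EFin \o (fun x => h x - k_ N x)).
    exact: iB.
  have ihkv : m.-integrable setT (EFin \o (fun x => h x * v x - k_ N x * v x)).
    by apply: iB; exact: integrableM.
  apply: (le_trans (le_normr_Rintegral _ ihkv)) => //.
  apply: (@le_trans _ _ (\int[m]_x (M * `|h x - k_ N x|))).
    apply: le_Rintegral => //.
    - exact: iN.
    - by apply: iZ; exact: iN.
    - by move=> x _; rewrite -mulrBl normrM mulrC ler_wpM2r.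
  rewrite RintegralZl//; last exact: iN.
  rewrite (@le_trans _ _ ((M + 1) * \int[m]_x `|h x - k_ N x|))//.
    by rewrite ler_wpM2r ?lerDl// Rintegral_ge0.
  by rewrite mulrC -ler_pdivlMr// ltr_wpDl.
have /cvgrPdist_le /(_ _ e3) := wk N.
apply: filterS => n kn.
have := dist _ (mu_ n) (u_M n); have := dist _ mu uM.
move: kn; rewrite !ler_norml => /andP[? ?] /andP[? ?] /andP[? ?].
by apply/andP; split; lra.
Qed.

Let iindic A : measurable A -> m.-integrable setT (EFin \o (\1_A : T -> R)).
Proof. by move=> mA; exact: integrable_indic. Qed.

(** The sets whose indicators satisfy the convergence form a lambda-system: the
    uniform bound on the functions makes the convergence stable under [L^1]
    limits, in particular under increasing unions. *)
Lemma weak_cvg_indic : (forall A, G A -> weak (\1_A)) ->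
  forall A, measurable A -> weak (\1_A).
Proof.
move=> wG A mA; suff : [set A | measurable A /\ weak (\1_A)] A by case.
suff H : <<s G >> `<=` [set A | measurable A /\ weak (\1_A)] by apply: H; rewrite -mG.
apply: (@lambda_system_subset _ G setIG setT); last by [].
- split => //.
  + by split => //; exact: wG.
  + move=> C B BC [mC wC] [mB wB]; split; first exact: measurableD.
    have -> : \1_(C `\` B) = (\1_C : T -> R) \+ (fun x => (-1) * \1_B x).
      apply/funext => x; rewrite /= !indicE in_setD.
      have [xB|xB] := boolP (x \in B).
        by rewrite (mem_set (BC _ (set_mem xB)))/= mulN1r subrr.
      by rewrite andbT mulN1r subr0.
    apply: weakD; [exact: iindic| |exact: wC|].
      by apply: iZ; exact: iindic.
    by apply: weakZ => //; exact: iindic.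
  + move=> Fs ndF FH.
    have mF k : measurable (Fs k) by case: (FH k).
    have mU : measurable (\bigcup_k Fs k) by exact: bigcupT_measurable.
    split => //; apply: (approx (k_ := fun k => \1_(Fs k))).
    * exact: iindic.
    * by move=> k; exact: iindic.
    * by move=> k; case: (FH k).
    * have E k : \int[m]_x `|\1_(\bigcup_k Fs k) x - \1_(Fs k) x| =
          fine (m (\bigcup_k Fs k)) - fine (m (Fs k)).
        have -> : \int[m]_x `|\1_(\bigcup_k Fs k) x - \1_(Fs k) x| =
            \int[m]_x (\1_(\bigcup_k Fs k) x - \1_(Fs k) x).
          apply: eq_Rintegral => x _; rewrite ger0_norm// subr_ge0 !indicE.
          rewrite ler_nat; have [xF|//] := boolP (x \in Fs k).
          by rewrite mem_set//; exists k => //; exact: set_mem.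
        rewrite RintegralB//; [|exact: iindic|exact: iindic].
        by rewrite /Rintegral !integral_indic// !setIT.
      under eq_fun do rewrite E.
      rewrite -(subrr (fine (m (\bigcup_k Fs k)))).
      apply: cvgB; first exact: cvg_cst.
      apply: fine_cvg; rewrite fineK ?fin_num_measure//.
      exact: nondecreasing_cvg_mu.
- by move=> C GC; split; [rewrite mG; exact: sub_sigma_algebra|exact: wG].
Qed.

Import HBSimple.

(** From indicators to simple functions by linearity, and to integrable functions
    by [L^1] density. *)
Lemma weak_cvg_integrable : (forall A, G A -> weak (\1_A)) ->
  forall h : T -> R, m.-integrable setT (EFin \o h) -> weak h.
Proof.
move=> wG h ih.
have wI := weak_cvg_indic wG.
have wsum (s : seq R) (A : R -> set T) : (forall r, measurable (A r)) ->
    m.-integrable setT (EFin \o (fun x => \sum_(r <- s) r * \1_(A r) x)) /\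
    weak (fun x => \sum_(r <- s) r * \1_(A r) x).
  move=> mA; elim: s => [|r s [iIH wIH]].
    have -> : (fun x => \sum_(r <- [::]) r * \1_(A r) x) = (fun x => 0 * \1_set0 x).
      by apply/funext => x; rewrite big_nil mul0r.
    by split; [apply: iZ|apply: weakZ]; [exact: iindic|exact: iindic|exact: wI].
  have -> : (fun x => \sum_(q <- r :: s) q * \1_(A q) x) =
      (fun x => r * \1_(A r) x) \+ (fun x => \sum_(q <- s) q * \1_(A q) x).
    by apply/funext => x; rewrite big_cons.
  have irA : m.-integrable setT (EFin \o (fun x => r * \1_(A r) x)).
    by apply: iZ; exact: iindic.
  split; first exact: (integrableD measurableT irA iIH).
  by apply: weakD => //; apply: weakZ; [exact: iindic|exact: wI].
have [k_ [ik kh khL]] := approximation_sfun_integrable measurableT ih.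
apply: (approx (k_ := fun n x => k_ n x)) => //.
  move=> n.
  have -> : (fun x => k_ n x) = fun x =>
      \sum_(r <- finmap.enum_fset (fset_set (range (k_ n)))) r * \1_(k_ n @^-1` [set r]) x.
    by apply/funext => x; rewrite fimfunE fsbig_finite.
  apply: (wsum _ (fun r => k_ n @^-1` [set r]) _).2 => r.
  by apply: measurable_preimage => //; exact: measurable_set1.
apply: fine_cvg.
by [].
Qed.

End weak_convergence.

(** * Half-open boxes *)

Section half_open_boxes.
Context {R : realType} {n : nat}.

Definition ocbox (p q : 'I_n -> R) : set 'rV[R]_n :=
  rectangle (fun i => `]p i, q i]%classic).

Lemma measurable_ocbox p q : measurable (ocbox p q).
Proof. by apply: measurable_rectangle => i; exact: measurable_itv. Qed.

Lemma ocboxI p q p' q' : ocbox p q `&` ocbox p' q' =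
  ocbox (fun i => Num.max (p i) (p' i)) (fun i => Num.min (q i) (q' i)).
Proof.
apply/seteqP; split => [x [/= xpq xpq'] i|x /= xpq].
  move: (xpq i) (xpq' i); rewrite /= !in_itv/= gt_max le_min.
  by move=> /andP[-> ->] /andP[-> ->].
split=> i; move: (xpq i); rewrite /= !in_itv/= gt_max le_min.
  by move=> /andP[/andP[-> _] /andP[-> _]].
by move=> /andP[/andP[_ ->] /andP[_ ->]].
Qed.

(** The whole space is included because it need not be a half-open box, while the
    pi-lambda theorem asks for it. *)
Definition ocboxes : set (set 'rV[R]_n) :=
  [set A | A = setT \/ exists p q, A = ocbox p q].

Lemma setI_closed_ocboxes : setI_closed ocboxes.
Proof.
move=> A B [->|[p [q ->]]] [->|[p' [q' ->]]].
- by left; rewrite setTI.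
- by right; exists p', q'; rewrite setTI.
- by right; exists p, q; rewrite setIT.
- by right; eexists; eexists; exact: ocboxI.
Qed.

Lemma measurable_ocboxes : measurable = <<s ocboxes >>.
Proof.
apply/seteqP; split; last first.
  apply: smallest_sub; first exact: sigma_algebra_measurable.
  by move=> _ [->|[p [q ->]]]; [exact: measurableT|exact: measurable_ocbox].
apply: smallest_sub; first exact: smallest_sigma_algebra.
rewrite -bigcup_seq/=; apply: bigcup_sub => i _ _ [B mB <-].
rewrite setTI; move: B mB; apply: smallest_sub.
  split=> [|B sB|Bs sBs].
  - rewrite preimage_set0; exact: sigma_algebra0.
  - by rewrite setTD preimage_setC -setTD; exact: sigma_algebraCD.
  - by rewrite preimage_bigcup; exact: sigma_algebra_bigcup.
move=> _ [[p q] _ <-] /=.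
(* A slab in the coordinate [i] is exhausted by boxes with sides [(-k, k]] in
   the other coordinates. *)
rewrite (_ : _ @^-1` _ = \bigcup_k ocbox (fun j => if j == i then p else - k%:R)
    (fun j => if j == i then q else k%:R)).
  apply: sigma_algebra_bigcup => k; apply: sub_sigma_algebra.
  by right; eexists; eexists.
apply/seteqP; split => [x /= xpq|x [k _ /(_ i)]]; last by rewrite /= eqxx.
pose k := (\max_(i < n) Num.bound `|x ord0 i|)%N.
exists k => // j /=; case: eqP => [->//|_].
have : `|x ord0 j| < k%:R.
  rewrite (lt_le_trans (archi_boundP (normr_ge0 _)))//.
  by rewrite ler_nat; exact: (leq_bigmax (F := fun i => Num.bound `|x ord0 i|%R) j).
by rewrite ltr_norml in_itv/= => /andP[-> /ltW ->].
Qed.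

Lemma ocbox_measure_fin p q :
  fin_num_fun (mrestr (@lebesgue_rV R n) (measurable_ocbox p q)).
Proof.
move=> A mA; rewrite ge0_fin_numE//.
apply: (@le_lt_trans _ _ (lebesgue_rV (box (\row_i p i) (\row_i q i)))); last first.
  have := @box_measure_fin R n (\row_i p i) (\row_i q i) _ measurableT.
  by rewrite /box_measure /mrestr setTI fin_numElt => /andP[].
rewrite /= /mrestr le_measure ?inE//; last 2 first.
- exact: measurable_box.
- move=> x [_ xpq] i; have := xpq i; rewrite /= in_itv/= !mxE => /andP[+ ->].
  by move=> /ltW ->.
- by apply: measurableI => //; exact: measurable_ocbox.
Qed.

Definition ocbox_measure p q : set 'rV[R]_n -> \bar R :=
  mrestr lebesgue_rV (measurable_ocbox p q).
HB.instance Definition _ p q := Measure.on (ocbox_measure p q).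
HB.instance Definition _ p q :=
  @Measure_isFinite.Build _ _ _ (ocbox_measure p q) (@ocbox_measure_fin p q).

End half_open_boxes.

(** * Approximate identity *)

Lemma Rintegral_mrestr {R : realType} d (T : measurableType d) (m : {measure set T -> \bar R})
    (D : set T) (mD : measurable D) (f : T -> R) : measurable_fun setT f ->
  \int[mrestr m mD]_x f x = \int[m]_x ((f \_ D) x).
Proof.
move=> mf; rewrite -Rintegral_mkcond /Rintegral integral_mrestr//.
exact/measurable_EFinP.
Qed.

Section box_averages.
Context {R : realType} {d : nat}.
Variables (a b : 'rV[R]_d) (F : nat -> R -> R) (CF : nat -> R).
Hypothesis dF : forall m (x : R), is_derive x (1:R) (F m) (F m.+1 x).
Hypothesis FC : forall m x, `|F m x| <= CF m.
Hypothesis F1_ge0 : forall x : R, 0 <= F 1%N x.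
Variable psi : 'rV[R]_d -> R.
Hypothesis bpsi : bounded_borel psi.
Local Notation mu := (box_measure a b).

Lemma integral_step_ocbox (p q : 'I_d -> R) (y : 'rV[R]_d) : (forall i, p i <= q i) ->
  (\int[ocbox_measure p q]_x (\prod_(i < d) F 1%N (x ord0 i - y ord0 i))%:E =
  (\prod_(i < d) (F 0%N (q i - y ord0 i) - F 0%N (p i - y ord0 i)))%:E)%E.
Proof.
move=> pq.
under eq_integral do rewrite -prodEFin.
have mu1 i : measurable_fun setT (fun t : R => (F 1%N (t - y ord0 i))%:E).
  apply/measurable_EFinP; apply: (measurable_step dF).
  exact: measurable_funB.
have u0 i t : (0 <= (F 1%N (t - y ord0 i))%:E)%E by rewrite lee_fin.
rewrite ge0_integral_mrestr; first last.
- by move=> x; elim/big_ind : _ => //; exact: mule_ge0.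
- apply: measurable_fun_prode => i.
  exact: (measurableT_comp (mu1 i) (measurable_rV_coord i)).
rewrite (integral_tensor_rectangle (u := fun i t => (F 1%N (t - y ord0 i))%:E))//.
rewrite -prodEFin; apply: eq_bigr => i _.
rewrite integral_itv_obnd_cbnd//; last exact: measurable_funTS.
apply: (integral_is_derive (pq i)
  (fun t : R => @is_derive_shift_arg R _ _ (y ord0 i) t (dF 0%N))).
exact: (continuous_is_derive (fun t : R => @is_derive_shift_arg R _ _ (y ord0 i) t (dF 1%N))).
Qed.

Let K (xy : 'rV[R]_d * 'rV[R]_d) :=
  psi xy.2 * \prod_(i < d) F 1%N (xy.1 ord0 i - xy.2 ord0 i).

Let bK : bounded_borel K.
Proof.
apply: bounded_borelM; first exact: (bounded_borel_comp bpsi measurable_snd).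
apply: bounded_borel_prod => i; split; last by exists (CF 1%N).
apply: (measurable_step dF); apply: measurable_funB.
  exact: (measurableT_comp (measurable_rV_coord i) measurable_fst).
exact: (measurableT_comp (measurable_rV_coord i) measurable_snd).
Qed.

(** Fubini leaves one-dimensional integrals of the bump, whose primitive is the
    step. *)
Lemma integral_mollification_ocbox (p q : 'I_d -> R) : (forall i, p i <= q i) ->
  \int[ocbox_measure p q]_x (mollification a b F psi x) =
  \int[mu]_y (psi y * \prod_(i < d) (F 0%N (q i - y ord0 i) - F 0%N (p i - y ord0 i))).
Proof.
move=> pq.
have iK := @bounded_borel_integrable_prod _ _ _ _ _ (ocbox_measure p q) mu _ bK.
rewrite /Rintegral; congr fine.
transitivity (\int[ocbox_measure p q]_x \int[mu]_y (K (x, y))%:E)%E.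
  apply: eq_integral => x _; rewrite fineK//.
  have := bounded_borel_integrable mu (bounded_borel_comp bK (pair1_measurable x)).
  by move/integrable_fin_num; exact.
rewrite (Fubini iK); apply: eq_integral => y _.
rewrite [RHS]EFinM -(integral_step_ocbox y pq) -integralZl//.
apply: (bounded_borel_integrable (ocbox_measure p q)).
apply: bounded_borel_prod => i; split; last by exists (CF 1%N).
apply: (measurable_step dF); apply: measurable_funB => //.
exact: measurable_rV_coord.
Qed.

Lemma measurable_mollification : measurable_fun setT (mollification a b F psi).
Proof.
have iK := @bounded_borel_integrable_prod _ _ _ _ _ mu mu _ bK.
have mG := measurable_fubini_F iK.
rewrite (_ : mollification a b F psi = fine \o fubini_F mu (EFin \o K))//.
by apply: (@measurableT_comp _ _ _ _ _ _ fine).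
Qed.

End box_averages.

Section rescaling.
Context {R : realType}.
Variables (F : nat -> R -> R) (CF : nat -> R).
Hypothesis dF : forall m (x : R), is_derive x (1:R) (F m) (F m.+1 x).
Hypothesis FC : forall m x, `|F m x| <= CF m.
Hypothesis Fl : forall x : R, x <= -1 -> F 0%N x = 0.
Hypothesis Fr : forall x : R, 0 <= x -> F 0%N x = 1.
Hypothesis F1_ge0 : forall x : R, 0 <= F 1%N x.

(** The [m]-th derivative of [x |-> F 0 ((n + 1) x)]. *)
Definition rescaled_step (n m : nat) (x : R) : R := n.+1%:R ^+ m * F m (n.+1%:R * x).

Lemma rescaled_step_derive n m (x : R) :
  is_derive x (1:R) (rescaled_step n m) (rescaled_step n m.+1 x).
Proof.
have dg : is_derive x (1:R) (fun x : R => n.+1%:R * x) n.+1%:R.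
  by have := is_deriveZ n.+1%:R (is_derive_id x (1:R)); rewrite /GRing.scale/= mulr1.
have := is_deriveZ (n.+1%:R ^+ m)
  (@is_derive1_comp R (F m) (fun x => n.+1%:R * x) x _ _ (dF m (n.+1%:R * x)) dg).
rewrite /rescaled_step exprSr /GRing.scale/= -mulrA [n.+1%:R * F _ _]mulrC.
done.
Qed.

Lemma rescaled_step_bound n m x : `|rescaled_step n m x| <= n.+1%:R ^+ m * CF m.
Proof. by rewrite normrM ger0_norm ?exprn_ge0// ler_wpM2l ?exprn_ge0. Qed.

Lemma rescaled_step_left n x : x <= -1 -> rescaled_step n 0 x = 0.
Proof.
move=> x1; rewrite /rescaled_step expr0 mul1r Fl//.
have : (1:R) <= n.+1%:R by rewrite ler1n.
by nra.
Qed.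

Lemma rescaled_step_right n x : 0 <= x -> rescaled_step n 0 x = 1.
Proof. by move=> x0; rewrite /rescaled_step expr0 mul1r Fr// mulr_ge0. Qed.

Lemma rescaled_step_ge0 n x : 0 <= rescaled_step n 1 x.
Proof. by rewrite /rescaled_step mulr_ge0. Qed.

(** The step equals [1] on the whole half-line [0 <= x], which is why half-open boxes
    closed on the right appear in the limit without exceptional points. *)
Lemma rescaled_step_cvg (x : R) : rescaled_step n 0 x @[n --> \oo] --> ((0 <= x)%R%:R : R).
Proof.
have [x0|x0] := leP 0 x.
  by under eq_fun do rewrite rescaled_step_right//; exact: cvg_cst.
apply: cvg_near_cst; near=> n; rewrite /rescaled_step expr0 mul1r Fl//.
have : - x^-1 < n.+1%:R.
  by rewrite (lt_trans (_ : _ < n%:R)) ?ltr_nat//; near: n; exact: nbhs_infty_gtr.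
rewrite -[_ <= _]lerN2 opprK => nx.
rewrite -mulrN -ler_pdivrMr ?oppr_gt0// mul1r invrN.
exact: ltW.
Unshelve. all: by end_near. Qed.

End rescaling.

Section approximate_identity.
Context {R : realType} {d : nat}.
Variables (a b : 'rV[R]_d) (F : nat -> R -> R) (CF : nat -> R).
Hypothesis ab : forall i, a ord0 i < b ord0 i.
Hypothesis dF : forall m (x : R), is_derive x (1:R) (F m) (F m.+1 x).
Hypothesis FC : forall m x, `|F m x| <= CF m.
Hypothesis Fl : forall x : R, x <= -1 -> F 0%N x = 0.
Hypothesis Fr : forall x : R, 0 <= x -> F 0%N x = 1.
Hypothesis F1_ge0 : forall x : R, 0 <= F 1%N x.
Variable psi : 'rV[R]_d -> R.
Hypothesis bpsi : bounded_borel psi.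
Local Notation mu := (box_measure a b).
Local Notation u_ n := (mollification a b (rescaled_step F n) psi).

(** The primitives of the mollifier converge everywhere to the indicator of the box,
    boundedly. *)
Lemma cvg_mollification_ocbox (p q : 'I_d -> R) :
  \int[ocbox_measure p q]_x (u_ n x) @[n --> \oo] -->
  \int[mu]_y (psi y * \1_(ocbox p q) y).
Proof.
have [pq|npq] := pselect (forall i, p i <= q i); last first.
  have E : ocbox p q = set0.
    rewrite -subset0 => x xpq; apply: npq => i.
    by have := xpq i; rewrite /= in_itv/= => /andP[px xq]; rewrite ltW// (lt_le_trans px).
  have E0 n : \int[ocbox_measure p q]_x (u_ n x) = 0.
    rewrite Rintegral_mrestr; last exact: (measurable_mollification a b
      (rescaled_step_derive dF n) (rescaled_step_bound FC n) bpsi).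
    rewrite E -[RHS](mul0r (fine (lebesgue_rV [set: 'rV[R]_d]))) -Rintegral_cst//.
    by apply: eq_Rintegral => x _; rewrite patchE memNset.
  under eq_fun do rewrite E0.
  rewrite (_ : Rintegral _ _ _ = 0); first exact: cvg_cst.
  rewrite -[RHS](mul0r (fine (mu setT))) -Rintegral_cst//.
  by apply: eq_Rintegral => y _; rewrite E indic0 mulr0.
have mpsi : measurable_fun setT psi by case: bpsi.
have [M psiM] : exists M, forall x, `|psi x| <= M by case: bpsi.
pose w n (y : 'rV[R]_d) := psi y * \prod_(i < d)
  (rescaled_step F n 0 (q i - y ord0 i) - rescaled_step F n 0 (p i - y ord0 i)).
have -> : (fun n => \int[ocbox_measure p q]_x (u_ n x)) = fun n => \int[mu]_y w n y.
  apply/funext => n.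
  exact: (integral_mollification_ocbox a b (rescaled_step_derive dF n)
    (rescaled_step_bound FC n) (rescaled_step_ge0 F1_ge0 n) bpsi pq).
have mw n : measurable_fun setT (w n).
  apply: measurable_funM => //; apply: measurable_prod => i _.
  by apply: measurable_funB; apply: (measurable_step (rescaled_step_derive dF n));
    apply: measurable_funB => //; exact: measurable_rV_coord.
have m1 : measurable_fun setT (fun y => psi y * \1_(ocbox p q) y).
  apply: measurable_funM => //; exact: measurable_indic (measurable_ocbox p q).
have w1 y : w n y @[n --> \oo] --> psi y * \1_(ocbox p q) y.
  apply: cvgM; first exact: cvg_cst.
  have -> : \1_(ocbox p q) y = \prod_(i < d)
      ((0 <= q i - y ord0 i)%R%:R - (0 <= p i - y ord0 i)%R%:R) :> R.
    rewrite indicE; have [yB|yB] := boolP (y \in ocbox p q).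
      rewrite big1// => i _; have := set_mem yB i; rewrite /= in_itv/= => /andP[py yq].
      by rewrite !subr_ge0 yq leNgt py subr0.
    have [i yi] : exists i, ~ (p i < y ord0 i <= q i).
      apply: contrapT => H; move/negP: yB; apply; rewrite inE => i.
      by rewrite /= in_itv/=; apply: contrapT => yi; apply: H; exists i.
    rewrite (bigD1 i)//= !subr_ge0; move/negP: yi; rewrite negb_and -leNgt -ltNge.
    case/orP => yi.
      by rewrite yi (le_trans yi (pq i)) subrr mul0r.
    by rewrite leNgt yi/= leNgt (le_lt_trans (pq i) yi) subrr mul0r.
  elim: (index_enum _) => [|i s IH].
    by under eq_fun do rewrite big_nil; rewrite big_nil; exact: cvg_cst.
  under eq_fun do rewrite big_cons.
  rewrite big_cons; apply: cvgM => //.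
  by apply: cvgB; exact: rescaled_step_cvg.
apply: fine_cvg; rewrite fineK; last first.
  apply: integrable_fin_num => //; apply: (bounded_borel_integrable mu).
  apply: bounded_borelM => //; split.
    exact: measurable_indic (measurable_ocbox p q).
  by exists 1 => y; rewrite indicE ger0_norm// lern1 leq_b1.
have wM n y : `|w n y| <= M.
  rewrite /w normrM normr_prod -[leRHS]mulr1; apply: ler_pM => //.
    exact: prodr_ge0.
  apply: (@le_trans _ _ (\prod_(i < d) (1:R))); last by rewrite big1.
  apply: ler_prod => i _; rewrite normr_ge0 ler_norml.
  have h1 := step_ge0 (rescaled_step_derive dF n) (rescaled_step_left Fl n)
    (rescaled_step_ge0 F1_ge0 n).
  have h2 := step_le1 (rescaled_step_derive dF n) (rescaled_step_right Fr n)
    (rescaled_step_ge0 F1_ge0 n).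
  have := h1 (q i - y ord0 i); have := h2 (q i - y ord0 i).
  have := h1 (p i - y ord0 i); have := h2 (p i - y ord0 i).
  by move=> ? ? ? ?; apply/andP; split; lra.
have [] := @dominated_convergence _ _ _ mu setT measurableT (fun n y => (w n y)%:E)
  (fun y => (psi y * \1_(ocbox p q) y)%:E) (cst M%:E).
- by move=> n; exact/measurable_EFinP.
- exact/measurable_EFinP.
- apply: aeW => y _; apply: cvg_EFin; last exact: w1.
  by apply: nearW.
- exact: finite_measure_integrable_cst.
- by apply: aeW => y n _; rewrite lee_fin.
by move=> _ _; apply.
Qed.

End approximate_identity.

(** * Duality with the mixed derivative *)

Section duality.
Context {R : realType} {d : nat}.
Variables (a b : 'rV[R]_d) (I : {set 'I_d}) (F : nat -> R -> R) (CF : nat -> R).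
Hypothesis ab : forall i, a ord0 i < b ord0 i.
Hypothesis dF : forall m (x : R), is_derive x (1:R) (F m) (F m.+1 x).
Hypothesis FC : forall m x, `|F m x| <= CF m.
Hypothesis Fl : forall x : R, x <= -1 -> F 0%N x = 0.
Hypothesis Fr : forall x : R, 0 <= x -> F 0%N x = 1.
Hypothesis F1_ge0 : forall x : R, 0 <= F 1%N x.
Variable psi : 'rV[R]_d -> R.
Hypothesis bpsi : bounded_borel psi.
Local Notation mu := (box_measure a b).
Local Notation u_ n := (mollification a b (rescaled_step F n) psi).

Let mu_ n : measurable_fun setT (u_ n) :=
  measurable_mollification a b (rescaled_step_derive dF n) (rescaled_step_bound FC n) bpsi.

Let mpsi : measurable_fun setT psi. Proof. by case: bpsi. Qed.

(* Any half-open box around [prod [a_i - 1, b_i]] would do, the rescaled bumps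
   being supported in [[-1, 0]]. *)
Let p0 (i : 'I_d) : R := a ord0 i - 2.
Let q0 (i : 'I_d) : R := b ord0 i + 1.

Lemma mollification_support n x : ~ ocbox p0 q0 x -> u_ n x = 0.
Proof.
move=> xB; have [i xi] : exists i, ~ (p0 i < x ord0 i <= q0 i).
  apply: contrapT => H; apply: xB => i.
  by rewrite /= in_itv/=; apply: contrapT => xi; apply: H; exists i.
have mP : measurable_fun setT (fun y : 'rV[R]_d => psi y *
    \prod_(i < d) rescaled_step F n 1 (x ord0 i - y ord0 i)).
  apply: measurable_funM => //; apply: measurable_prod => j _.
  apply: (measurable_step (rescaled_step_derive dF n)); apply: measurable_funB => //.
  exact: measurable_rV_coord.
rewrite /mollification Rintegral_mrestr//.
rewrite -[RHS](mul0r (fine (lebesgue_rV [set: 'rV[R]_d]))) -Rintegral_cst//.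
apply: eq_Rintegral => y _; rewrite patchE; case: ifPn => // yab.
have {}yab := set_mem yab.
rewrite (bigD1 i)//= (step_derive_eq0 (rescaled_step_derive dF n) (rescaled_step_left Fl n)
   (rescaled_step_right Fr n)) ?mul0r ?mulr0//.
move/negP: xi; rewrite negb_and -leNgt -ltNge /p0 /q0.
by have /andP[? ?] := yab i; case/orP => ?; [left|right]; lra.
Qed.

(** The mollifications live in a fixed bounded box, on which weak convergence can be
    tested on sub-boxes. *)
Lemma mollification_cvg (h : 'rV[R]_d -> R) : lebesgue_rV.-integrable setT (EFin \o h) ->
  \int[lebesgue_rV]_x (h x * u_ n x) @[n --> \oo] --> \int[mu]_x (h x * psi x).
Proof.
move=> ih.
have mh : measurable_fun setT h by apply/measurable_EFinP; exact: measurable_int ih.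
have [M psiM] : exists M, forall x, `|psi x| <= M by case: bpsi.
pose m0 := ocbox_measure p0 q0.
pose u x := psi x * \1_(box a b) x.
have mu' : measurable_fun setT u.
  by apply: measurable_funM => //; exact: measurable_indic (measurable_box a b).
have boxB x : box a b x -> ocbox p0 q0 x.
  move=> xab i; rewrite /= in_itv/= /p0 /q0; have /andP[? ?] := xab i.
  by apply/andP; split; lra.
have -> : (fun n => \int[lebesgue_rV]_x (h x * u_ n x)) =
    (fun n => \int[m0]_x (h x * u_ n x)).
  apply/funext => n; rewrite Rintegral_mrestr; last exact: measurable_funM.
  apply: eq_Rintegral => x _; rewrite patchE; case: ifPn => // xB.
  by rewrite mollification_support ?mulr0// => H; move/negP: xB; apply; rewrite inE.
have -> : \int[mu]_x (h x * psi x) = \int[m0]_x (h x * u x).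
  rewrite !Rintegral_mrestr; [|exact: measurable_funM|exact: measurable_funM].
  apply: eq_Rintegral => x _; rewrite !patchE /u indicE.
  case: (boolP (x \in box a b)) => xab; last by rewrite !mulr0; case: ifP.
  by rewrite mem_set ?mulr1//; exact/boxB/set_mem.
have ihm : (ocbox_measure p0 q0).-integrable setT (EFin \o h).
  have [_ hoo] := integrableP _ _ _ ih.
  apply/integrableP; split; first exact/measurable_EFinP.
  rewrite ge0_integral_mrestr//; last exact: measurable_abse_EFin.
  apply: le_lt_trans hoo; apply: ge0_subset_integral => //.
    exact: measurable_ocbox.
  exact: measurable_abse_EFin.
apply: (@weak_cvg_integrable _ _ _ (ocbox_measure p0 q0) ocboxes (fun n => u_ n) u M
   measurable_ocboxes setI_closed_ocboxes _ mu_ mu') => //.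
- by left.
- move=> n; exact: (mollification_bound ab (rescaled_step_derive dF n)
    (rescaled_step_bound FC n) (rescaled_step_left Fl n) (rescaled_step_right Fr n)
    (rescaled_step_ge0 F1_ge0 n) bpsi psiM).
- by move=> x; rewrite /u normrM -[leRHS]mulr1 ler_pM// indicE ger0_norm// lern1 leq_b1.
move=> A HA.
(* Relative to the ambient box both kinds of generators are half-open boxes. *)
have [mA [p [q Apq]]] : measurable A /\ exists p q, A `&` ocbox p0 q0 = ocbox p q.
  case: HA => [->|[p [q ->]]].
    by split => //; exists p0, q0; rewrite setTI.
  by split; [exact: measurable_ocbox|do 2 eexists; exact: ocboxI].
have m1A : measurable_fun setT (\1_A : 'rV[R]_d -> R) by exact: measurable_indic.
have -> : (fun n => \int[ocbox_measure p0 q0]_x (\1_A x * u_ n x)) =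
    (fun n => \int[ocbox_measure p q]_x (u_ n x)).
  apply/funext => n; rewrite !Rintegral_mrestr//; last exact: measurable_funM.
  apply: eq_Rintegral => x _; rewrite !patchE -Apq in_setI indicE.
  by case: (x \in A) => /=; rewrite ?mul1r ?mul0r ?if_same.
have -> : \int[ocbox_measure p0 q0]_x (\1_A x * u x) =
    \int[mu]_y (psi y * \1_(ocbox p q) y).
  have mI : measurable_fun setT (\1_(ocbox p q) : 'rV[R]_d -> R).
    exact: measurable_indic (measurable_ocbox p q).
  rewrite !Rintegral_mrestr; [|exact: measurable_funM|exact: measurable_funM].
  apply: eq_Rintegral => x _; rewrite !patchE /u -Apq !indicE in_setI.
  case: (boolP (x \in box a b)) => xab; last by rewrite !mulr0; case: ifP.
  rewrite (_ : x \in ocbox p0 q0); last by rewrite mem_set//; exact/boxB/set_mem.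
  by rewrite andbT mulr1 mulrC.
exact: cvg_mollification_ocbox.
Qed.

Hypothesis psi_orth : forall i (w : 'rV[R]_d -> R), i \in I -> bounded_borel w ->
  (forall x t, w (update_rV i x t) = w x) -> \int[mu]_y (psi y * w y) = 0.

(** The definition of the mixed derivative, tested on the mollified antiderivatives,
    bounds [int h u_n] by their supremum times the total variation, uniformly in
    the mollification scale. *)
Lemma duality_bound (h : 'rV[R]_d -> R) (nu : {charge set 'rV[R]_d -> \bar R})
    (P N : set 'rV[R]_d) (nuPN : hahn_decomposition nu P N) (L : R) :
  lebesgue_rV.-integrable setT (EFin \o h) ->
  mixed_derivative_eq I h nuPN -> 0 <= L ->
  (\forall u \ae box_measure (proj_rV (~: I) a) (proj_rV (~: I) b),
    (\int[box_measure (proj_rV I a) (proj_rV I b)]_t `|psi (merge_rV u t)|%:E <= L%:E)%E) ->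
  `|\int[mu]_x (h x * psi x)| <= 2 ^- #|I| * L * fine (charge_variation nuPN setT).
Proof.
move=> ih Dh L0 psiL.
pose z n := antiderivative a b I (rescaled_step F n) psi.
have zL n x : `|z n x| <= 2 ^- #|I| * L.
  exact: (antiderivative_bound ab (rescaled_step_derive dF n)
    (rescaled_step_bound FC n) (rescaled_step_left Fl n) (rescaled_step_right Fr n)
    (rescaled_step_ge0 F1_ge0 n) bpsi).
have mz n : measurable_fun setT (z n).
  exact: (measurable_antiderivative a b I (rescaled_step_derive dF n)
    (rescaled_step_bound FC n) bpsi).
have bound n : `|\int[lebesgue_rV]_x (h x * u_ n x)| <=
    2 ^- #|I| * L * fine (charge_variation nuPN setT).
  have := Dh (z n) (antiderivative_test_function a b I (rescaled_step_derive dF n)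
    (rescaled_step_bound FC n) (rescaled_step_left Fl n) (rescaled_step_right Fr n) bpsi).
  rewrite /mixed_derivative (partials_antiderivative (rescaled_step_derive dF n)
    (rescaled_step_bound FC n) bpsi psi_orth) => E.
  have -> : `|\int[lebesgue_rV]_x (h x * u_ n x)| =
      `|(-1) ^+ #|I| * \int[lebesgue_rV]_x (h x * u_ n x)|.
    by rewrite normrM normrX normrN1 expr1n mul1r.
  rewrite E.
  rewrite /charge_integral (le_trans (ler_normB _ _))//.
  rewrite /charge_variation /= fineD ?fin_num_measure// mulrDr lerD//.
    exact: (Rintegral_le (jordan_pos nuPN) (mz n) (zL n)).
  exact: (Rintegral_le (jordan_neg nuPN) (mz n) (zL n)).
set C := (leRHS).
have H : (fun n => `|\int[lebesgue_rV]_x (h x * u_ n x)|) n @[n --> \oo] -->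
    `|\int[mu]_x (h x * psi x)|.
  exact: (cvg_norm (mollification_cvg ih)).
have HC : (fun _ : nat => C) n @[n --> \oo] --> C by exact: cvg_cst.
apply: (@ler_cvg_to nat \oo _ R _ _ _ _ H HC).
exact: nearW.
Qed.

End duality.

(** * The mixed envelope *)

Section envelope.
Context {R : realType} {d : nat}.
Variables (a b : 'rV[R]_d) (I : {set 'I_d}).
Hypothesis ab : forall i, a ord0 i < b ord0 i.
Local Notation mu := (box_measure a b).
Local Notation m1 := (box_measure (proj_rV (~: I) a) (proj_rV (~: I) b)).
Local Notation m2 := (box_measure (proj_rV I a) (proj_rV I b)).

Lemma box_measure_gt0 n (p q : 'rV[R]_n) : (forall i, p ord0 i < q ord0 i) ->
  (0 < box_measure p q setT)%E.
Proof.
move=> pq; rewrite /box_measure /mrestr setTI.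
have -> := lebesgue_rV_box (fun i => ltW (pq i)).
by rewrite lte_fin; apply: prodr_gt0 => i _; rewrite subr_gt0.
Qed.

Lemma ae_merge (P : set 'rV[R]_d) : measurable P -> (\forall x \ae mu, P x) ->
  \forall u \ae m1, \forall t \ae m2, P (merge_rV u t).
Proof.
move=> mP [N [mN N0 PN]].
have m0 : (m1 \x m2)%E (@merge_pair R d I @^-1` N) = 0%E by rewrite box_merge.
have mS := measurable_preimage (@measurable_merge R d I) mN.
apply: filterS (null_xsection mS m0) => u Nu.
exists (xsection (@merge_pair R d I @^-1` N) u); split => //.
- exact: measurable_xsection.
- by move=> t Pt; rewrite /xsection /= inE/=; exact: PN.
Qed.

(** Membership in [L^oo] bounds [phi] only almost everywhere; a representative that
    is bounded everywhere makes all coordinate means pointwise meaningful. *)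
Lemma ess_bounded_truncation (phi : 'rV[R]_d -> R) : phi \in Lfun mu +oo%E ->
  exists2 phi', bounded_borel phi' & \forall x \ae mu, phi x = phi' x.
Proof.
move=> /[dup] /sub_Lfun_mfun; rewrite inE/= => mphi /sub_Lfun_finLfun.
rewrite inE/= /finite_norm unlock /Lnorm (box_measure_gt0 ab) => phioo.
have [M phiM] : exists M : R, \forall x \ae mu, `|phi x| <= M.
  have := ess_sup_ge mu (abse \o (EFin \o phi)).
  case: (ess_sup _ _) phioo => [r _|//|_].
    by move=> H; exists r; apply: filterS H => x /=; rewrite lee_fin.
  by move=> H; exists 0; apply: filterS H => x /=; rewrite leeNy_eq.
exists (fun x => phi x * \1_[set x | `|phi x| <= M] x).
  have mA : measurable [set x | `|phi x| <= M].
    rewrite -[X in measurable X]setTI; apply: measurable_fun_le => //.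
    exact: measurableT_comp.
  split; first by apply: measurable_funM => //; exact: measurable_indic.
  exists `|M| => x; rewrite indicE; case: (boolP (x \in _)) => [|_].
    by rewrite inE/= mulr1 => /le_trans; apply; exact: ler_norm.
  by rewrite mulr0 normr0.
by apply: filterS phiM => x xM; rewrite indicE mem_set ?mulr1.
Qed.

(** The envelope is an actual real number, so that no product [0 * oo] can occur, and
    it does not see the change of representative. *)
Lemma mixed_envelope_fin (psi0 psi : 'rV[R]_d -> R) (M : R) :
  measurable_fun setT psi0 -> measurable_fun setT psi ->
  (forall x, `|psi x| <= M) -> (\forall x \ae mu, psi0 x = psi x) ->
  exists L : R, [/\ 0 <= L, mixed_envelope a b I psi0 = L%:E &
    \forall u \ae m1, (\int[m2]_t `|psi (merge_rV u t)|%:E <= L%:E)%E].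
Proof.
move=> mpsi0 mpsi psiM psiE.
pose Lam := mixed_envelope a b I psi0.
have m1gt0 : (0 < m1 setT)%E by apply: box_measure_gt0 => k; rewrite !mxE.
have mmerge (u : 'rV[R]_#|~: I|) : measurable_fun setT (fun t => merge_rV (I:=I) u t).
  exact: (measurableT_comp (@measurable_merge R d I) (pair1_measurable u)).
have mabs (chi : 'rV[R]_d -> R) (u : 'rV[R]_#|~: I|) : measurable_fun setT chi ->
    measurable_fun setT (fun t => `|chi (merge_rV (I:=I) u t)|%:E).
  by move=> mchi; exact: (measurable_abse_EFin (measurableT_comp mchi (mmerge u))).
have envE : \forall u \ae m1, (\int[m2]_t `|psi0 (merge_rV u t)|%:E =
    \int[m2]_t `|psi (merge_rV u t)|%:E)%E.
  have mE : measurable [set x | psi0 x = psi x].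
    rewrite (_ : [set _ | _] = [set x | psi0 x == psi x]).
      by rewrite -[X in measurable X]setTI; exact: measurable_fun_eqr.
    by apply/seteqP; split => x /= /eqP.
  apply: filterS (ae_merge mE psiE) => u ut.
  apply: ge0_ae_eq_integral => //; [exact: mabs|exact: mabs|].
  have [N [mN N0 utN]] := ut; exists N; split => // t H; apply: utN => E.
  by apply: H => _ /=; rewrite E.
have Lam0 : (0 <= Lam)%E.
  by apply: ess_sup_gee => //; apply: aeW => u; exact: integral_ge0.
have LamM : (Lam <= M%:E * m2 setT)%E.
  apply/ess_supP; apply: filterS envE => u ->.
  rewrite -integral_cst//; apply: ge0_le_integral => //.
  - exact: mabs.
  - by move=> t _; rewrite lee_fin.
pose L := fine Lam.
have LE : Lam = L%:E.
  rewrite /L fineK// ge0_fin_numE// (le_lt_trans LamM)//.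
  by rewrite -ge0_fin_numE ?fin_numM ?fin_num_measure//; apply: le_trans LamM.
have L0 : 0 <= L by rewrite fine_ge0.
have psiL : \forall u \ae m1, (\int[m2]_t `|psi (merge_rV u t)|%:E <= L%:E)%E.
  have := ess_sup_ge m1 (fun u => \int[m2]_t `|psi0 (merge_rV u t)|%:E)%E.
  by apply: filterS2 envE => u -> uL; rewrite -LE.
by exists L.
Qed.

End envelope.

Theorem theorem2p25 (R : realType) (d : nat) (a b : 'rV[R]_d)
  (I : {set 'I_d}) (f : 'rV[R]_d -> R) :
  (1 <= d)%N ->
  (forall i, a ord0 i < b ord0 i) ->
  I != finset.set0 ->
  probability_density a b f ->
  (ext_mixed_variation a b I f < +oo)%E ->
  forall phi : 'rV[R]_d -> R, phi \in Lfun (box_measure a b) +oo%E ->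
  (`|density_expectation a b f phi|%:E <=
     (2 ^- #|I|)%:E * mixed_envelope a b I (mixed_proj a b I phi)
       * ext_mixed_variation a b I f
     + 'N[box_measure a b]_+oo[EFin \o mixed_rem a b I phi])%E.
Proof.
move=> _ ab _ [f1 f0 fT] Voo phi phioo.
set mu := box_measure a b.
have mphi : measurable_fun setT phi by move/sub_Lfun_mfun: phioo; rewrite inE.
have mf : measurable_fun setT f by move/sub_Lfun_mfun: f1; rewrite inE.
have intf : mu.-integrable setT (EFin \o f) by apply/Lfun1_integrable.
have [phi' bphi' phiE] := ess_bounded_truncation ab phioo.
have [mphi' _] := bphi'.
pose psi := mixed_proj a b I phi'.
have bpsi : bounded_borel psi by exact: bounded_borel_mixed_proj.
have [mpsi [M psiM]] := bpsi.
pose psi0 := mixed_proj a b I phi.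
have mpsi0 : measurable_fun setT psi0 by exact: measurable_mixed_proj.
have psiE : \forall x \ae mu, psi0 x = psi x by exact: ae_mixed_proj.
have psi_orth i (w : 'rV[R]_d -> R) : i \in I -> bounded_borel w ->
    (forall x t, w (update_rV i x t) = w x) -> \int[mu]_y (psi y * w y) = 0.
  by move=> iI bw wi; exact: (mixed_proj_orthogonal ab bphi' bw iI wi).
have [L [L0 LE psiL]] := mixed_envelope_fin I ab mpsi0 mpsi psiM psiE.
have [F [dF FCex Fl Fr F1_ge0]] := smooth_step_ex (R := R).
have /choice[CF FC] := FCex.
pose c := 2 ^- #|I| * L.
have c0 : 0 <= c by rewrite mulr_ge0.
have bound v : [set v | exists (h : 'rV[R]_d -> R) (nu : {charge set 'rV[R]_d -> \bar R})
      (P N : set 'rV[R]_d) (nuPN : hahn_decomposition nu P N),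
    [/\ h \in Lfun lebesgue_rV 1,
        {ae box_measure a b, forall x, h x = f x},
        mixed_derivative_eq I h nuPN &
        v = charge_variation nuPN setT]] v ->
    (`|\int[mu]_x (f x * psi x)|%:E <= c%:E * v)%E.
  move=> [h [nu [P [N [nuPN [h1 hf Dh ->]]]]]].
  have inth : lebesgue_rV.-integrable setT (EFin \o h) by apply/Lfun1_integrable.
  have mh : measurable_fun setT h by move/sub_Lfun_mfun: h1; rewrite inE.
  have -> : \int[mu]_x (f x * psi x) = \int[mu]_x (h x * psi x).
    congr fine; apply: ae_eq_integral => //.
    - by apply/measurable_EFinP; exact: measurable_funM.
    - by apply/measurable_EFinP; exact: measurable_funM.
    - by apply: filterS hf => x /= ->.
  have fin : charge_variation nuPN setT \is a fin_num.
    by rewrite /charge_variation /= fin_numD !fin_num_measure.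
  rewrite -(fineK fin) -EFinM lee_fin.
  exact: (duality_bound ab dF FC Fl Fr F1_ge0 bpsi psi_orth inth Dh L0 psiL).
have mfpsi : mu.-integrable setT (EFin \o (fun x => f x * psi x)).
  exact: integrable_mul_bounded intf mpsi psiM.
pose rem x := phi' x - psi x.
have [mrem [Mr remM]] : bounded_borel rem by exact: bounded_borelB.
have mfrem : mu.-integrable setT (EFin \o (fun x => f x * rem x)).
  exact: integrable_mul_bounded intf mrem remM.
have decomposition : density_expectation a b f phi =
    \int[mu]_x (f x * psi x) + \int[mu]_x (f x * rem x).
  rewrite -RintegralD//; congr fine; apply: ae_eq_integral => //.
  - by apply/measurable_EFinP; exact: measurable_funM.
  - apply/measurable_EFinP; apply: measurable_funD; exact: measurable_funM.
  - by apply: filterS phiE => x /= -> _; rewrite /rem; congr EFin; ring.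
have main_term : (`|\int[mu]_x (f x * psi x)|%:E <= c%:E * ext_mixed_variation a b I f)%E.
  (* Division by [c] needs [c > 0]; for [c = 0] a single extension suffices. *)
  have [w Sw _] := ereal_inf_lt Voo.
  move: c0; rewrite le_eqVlt => /predU1P[c0|c0].
    by have := bound _ Sw; rewrite -c0 !mul0e.
  rewrite -lee_pdivrMl//; apply/ereal_infP => v /bound.
  by rewrite lee_pdivrMl.
have rem_term : (`|\int[mu]_x (f x * rem x)|%:E <=
    'N[mu]_+oo[EFin \o mixed_rem a b I phi])%E.
  have := Lnorm_ge0 mu +oo (EFin \o mixed_rem a b I phi).
  rewrite unlock /Lnorm (box_measure_gt0 ab).
  have := ess_sup_ge mu (abse \o (EFin \o mixed_rem a b I phi)).
  case: (ess_sup _ _) => [r aer r0|_ _|//]; last by rewrite leey.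
  rewrite EFin_normr_Rintegral//.
  have mabs : measurable_fun setT (fun x => (r%:E * `|(f x)%:E|)%E).
    by apply: measurable_funeM; exact: measurable_abse_EFin.
  apply: (le_trans (le_abse_integral _ _ _)) => //.
    by apply/measurable_EFinP; exact: measurable_funM.
  apply: (@le_trans _ _ (\int[mu]_x (r%:E * `|(f x)%:E|))%E).
    apply: ae_ge0_le_integral => //.
    - by apply: measurable_abse_EFin; exact: measurable_funM.
    - by move=> x _; rewrite mule_ge0.
    - have H : \forall x \ae mu, `|rem x| <= r.
        move: aer; apply: filterS3 phiE psiE => x xphi xpsi.
        by rewrite /rem -xphi -xpsi /= lee_fin.
      apply: filterS H => x xr _.
      by rewrite /= lee_fin normrM mulrC ler_wpM2r.
  rewrite ge0_integralZl//; last exact: measurable_abse_EFin.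
  have -> : (\int[mu]_x `|(f x)%:E| = 1)%E.
    have : (\int[mu]_x (f x)%:E)%E = 1%E.
      rewrite -fT /Rintegral fineK//; exact: integrable_fin_num.
    move=> <-; apply: ae_eq_integral => //.
    - exact: measurable_abse_EFin.
    - exact/measurable_EFinP.
    - by apply: filterS f0 => x /= fx _; rewrite ger0_norm.
  by rewrite mule1.
rewrite decomposition (_ : mixed_envelope a b I (mixed_proj a b I phi) = L%:E)// -EFinM.
apply: le_trans (leeD main_term rem_term).
by rewrite -EFinD lee_fin; exact: ler_normD.
Qed.
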